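(* Let $X,X_1,X_2,\dots$ be i.i.d. real random variables, and let $S_n=\sum_{i=1}^nX_i$ and $G_n=\frac1n\sum_{i=1}^nS_i$ for $n\ge1$. Suppose that $\mathbb{P}(X\in b+h\mathbb{Z})=1$ for some $b\in\mathbb{R}$ and $h>0$, where $h$ is maximal (i.e. the largest positive number for which such a $b$ exists). Suppose also that $X$ has the same distribution as $-X$ and that $X$ is in the domain of normal attraction of a symmetric $\alpha$-stable distribution with $\alpha\in(0,1)$. Then, almost surely, $$\liminf_{n\to\infty}G_n=-\infty,\qquad\limsup_{n\to\infty}G_n=+\infty,\qquad\lim_{n\to\infty}|G_n|=\infty.$$
   Context: A symmetric $\alpha$-stable distribution is one with characteristic function $t\mapsto e^{-c|t|^\alpha}$ for some $c>0$. $X$ is in the domain of normal attraction of a stable law if there exist a constant $a>0$ and reals $b_n$ such that $(S_n-b_n)/(a\,n^{1/\alpha})$ converges in distribution to that law. *)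

(* Defs.v *)
From HB Require Import structures.
From mathcomp Require Import all_boot all_order all_algebra.
From mathcomp Require Import finmap.
From mathcomp Require Import complex.
From mathcomp Require Import all_classical all_reals all_analysis.

Set Implicit Arguments.
Unset Strict Implicit.
Unset Printing Implicit Defensive.

Import Order.TTheory GRing.Theory Num.Theory.
Import numFieldNormedType.Exports.

Local Open Scope classical_set_scope.
Local Open Scope ring_scope.

Section Defs.
Context {d : measure_display} {T : measurableType d} {R : realType}.
Variable P : probability T R.

(* Equality in law, for measurable X and Y.  Laws are compared on measurable
   sets only: P is a total function on [set T], unconstrained elsewhere. *)
Definition identically_distributed (X Y : T -> R) : Prop :=
  forall A : set R, measurable A -> P (X @^-1` A) = P (Y @^-1` A).

Definition mutually_independent (X : nat -> {RV P >-> R}) : Prop :=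
  forall (J : {fset nat}) (A : nat -> set R),
    (forall i, measurable (A i)) ->
    P (\bigcap_(i in [set` J]) (X i @^-1` A i)) =
    (\prod_(i <- J) P (X i @^-1` A i))%E.

(* X_1, X_2, ... are i.i.d. copies of Y; indices are shifted, so that X i
   stands for X_(i+1). *)
Definition iid_copies (Y : {RV P >-> R}) (X : nat -> {RV P >-> R}) : Prop :=
  mutually_independent X /\ forall i, identically_distributed (X i) Y.

(* S_n = X_1 + ... + X_n, with the shifted indices. *)
Definition walk (X : nat -> {RV P >-> R}) (n : nat) (w : T) : R :=
  \sum_(i < n) X i w.

(* G_n = (S_1 + ... + S_n) / n; the value at n = 0 is a junk 0. *)
Definition walk_mean (X : nat -> {RV P >-> R}) (n : nat) (w : T) : R :=
  n%:R^-1 * \sum_(1 <= i < n.+1) walk X i w.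

(* b + h Z *)
Definition lattice (b h : R) : set R := [set b + h * k%:~R | k in [set: int]].

Definition cvg_in_distribution (Z : nat -> T -> R) (mu : probability R R) : Prop :=
  forall f : R -> R, continuous f -> bounded_fun f ->
    ('E_P[f \o Z n])%E @[n --> \oo] --> (\int[mu]_x (f x)%:E)%E.

(* The common law of the X i, i.i.d., is in the domain of normal attraction of
   mu, an alpha-stable law.  The quotient at n = 0 is a junk 0. *)
Definition normal_attraction (X : nat -> {RV P >-> R}) (alpha : R)
    (mu : probability R R) : Prop :=
  exists (a : R) (b : nat -> R), 0 < a /\
    cvg_in_distribution
      (fun n w => (walk X n w - b n) / (a * n%:R `^ alpha^-1)) mu.

End Defs.

Definition char_fun {R : realType} (mu : probability R R) (t : R) : R[i] :=
  Complex (Rintegral mu [set: R] (fun x => cos (t * x)))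
          (Rintegral mu [set: R] (fun x => sin (t * x))).

Definition symmetric_stable {R : realType} (alpha : R) (mu : probability R R) : Prop :=
  exists2 c : R, 0 < c &
    forall t : R, char_fun mu t = (expR (- (c * `|t| `^ alpha)))%:C%C.

(* Main.v *)
Require Import Defs.
From HB Require Import structures.
From mathcomp Require Import all_boot all_order all_algebra.
From mathcomp Require Import finmap.
From mathcomp Require Import complex.
From mathcomp Require Import all_classical all_reals all_analysis.
From mathcomp Require Import measurable_realfun.
From mathcomp Require Import zify ring lra.

Set Implicit Arguments.
Unset Strict Implicit.
Unset Printing Implicit Defensive.

Import Order.TTheory GRing.Theory Num.Theory.
Import numFieldNormedType.Exports.

Local Open Scope classical_set_scope.
Local Open Scope ring_scope.

(** The arithmetic means G_n of the partial sums satisfy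
      n G_n = sum_(i < n) (n - i) X_i,
    a sum of independent symmetric variables of order n^(1 + 1/alpha).  The
    interval [-K n, K n] should therefore carry mass of order n^(-1/alpha),
    which is summable because alpha < 1, so that |G_n| <= K happens finitely
    often by the Borel-Cantelli lemma.  The sign of G_n is then settled by
    symmetry and a zero-one law.

    The mass of [-K n, K n] is estimated through phi(t) = E cos(t X), which is
    the characteristic function since X is symmetric.

    - Behaviour of phi near 0.  Domain of attraction says that
      phi(s_n)^(2n) converges in ]0, 1[ for s_n = 1 / (a n^(1/alpha)), whatever
      the centring, so 1 - phi(s_n) is of exact order 1/n
      ([attraction_charfun_power], [defect_of_cvg_power]).  To pass from the
      points s_n to all small t one uses that q = sqrt (1 - phi) is
      subadditive, being a multiple of the L^2 norm of sin (t X / 2): a greedy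
      expansion of t along (s_n) gives q(t) <= K t^(alpha/2), hence a modulus
      of continuity for q, which transports the lower bound from s_n to the
      whole interval [s_(n+1), s_n].  The outcome, [charfun_le_expR], is
      0 <= phi(t) <= exp(-k t^alpha) for small t > 0.

    - Product formula.  E cos(t n G_n) is the product of the phi(t (n - i)), at
      most exp(-(k/2) n (t n)^alpha) when t n is small
      ([expectation_cos_cumulated_walk_le]).

    - Concentration.  Integrating the Fejer kernel over a finite grid bounds
      P(|Y| <= r) by (4/N) sum_(m < N) |E cos(m delta Y)| as soon as
      N delta r is small: a discrete form of Esseen's inequality
      ([fejer_concentration]).  A grid of about n^gamma points with
      1 < gamma < 1/alpha gives P(|G_n| <= K) = O(n^(-gamma))
      ([mean_concentration]).

    - Oscillation.  By symmetry G_n >= 0 has probability at least 1/2 for each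
      n, so it happens infinitely often with probability at least 1/2; as
      |G_n| tends to infinity, limsup G_n = +oo has probability at least 1/2.
      Changing finitely many X_i changes G_n by a bounded amount, so this is a
      tail event, and its probability is 1 ([kolmogorov_zero_one],
      [probability_unbounded_event]).  The same applies to -G_n. *)

(** * Independence of generated sigma-algebras and of pairs *)

Section independence.
Context {d : measure_display} {T : measurableType d} {R : realType}.
Variable P : probability T R.

(** Two applications of the uniqueness theorem for finite measures: first with
    the second event fixed in [H], then with the first one fixed in <<s G >>. *)
Lemma independent_generated (G H : set (set T)) :
  G `<=` measurable -> H `<=` measurable ->
  setI_closed G -> setI_closed H -> G setT -> H setT ->
  (forall A B, G A -> H B -> P (A `&` B) = P A * P B)%E ->
  forall A B, <<s G >> A -> <<s H >> B -> (P (A `&` B) = P A * P B)%E.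
Proof.
move=> Gm Hm GI HI GT HT GH.
have half (K : set (set T)) B : K `<=` measurable -> setI_closed K ->
    K setT -> measurable B ->
    (forall A, K A -> P (A `&` B) = P A * P B)%E ->
    forall A, <<s K >> A -> (P (A `&` B) = P A * P B)%E.
  move=> Km KI KT mB KB A sA.
  pose r : {nonneg R} := NngNum (fine_ge0 (measure_ge0 P B)).
  have rE : r%:num%:E = P B by rewrite /= fineK// fin_num_measure.
  have m2E C : mscale r P C = (P C * P B)%E by rewrite /mscale rE muleC.
  rewrite -m2E; apply: (g_sigma_algebra_measure_unique K Km (fun=> setT)
    (fun=> KT) _ (mrestr P mB) (mscale r P)) => //.
  - by apply/seteqP; split=> // x _; exists 0%N.
  - by move=> C KC; exact: etrans (KB _ KC) (esym (m2E C)).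
  - move=> _; change (P (setT `&` B) < +oo)%E; rewrite setTI.
    by rewrite (le_lt_trans (probability_le1 P mB))// ltry.
have mG : <<s G >> `<=` measurable.
  by apply: smallest_sub => //; exact: sigma_algebra_measurable.
move=> A B sA sB; rewrite setIC muleC.
apply: (half H A) => //; first exact: mG.
move=> C HC; rewrite setIC muleC.
by apply: (half G) => //; [exact: Hm|move=> D GD; exact: GH].
Qed.

Definition independent_pair (Z W : T -> R) : Prop :=
  forall A B : set R, measurable A -> measurable B ->
    (P (Z @^-1` A `&` W @^-1` B) = P (Z @^-1` A) * P (W @^-1` B))%E.

Section joint_law.
Variables Z W : T -> R.
Hypotheses (mZ : measurable_fun setT Z) (mW : measurable_fun setT W).
Hypothesis ZW : independent_pair Z W.

Let Zf : {mfun T >-> R} := HB.pack Z (isMeasurableFun.Build _ _ _ _ Z mZ).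
Let Wf : {mfun T >-> R} := HB.pack W (isMeasurableFun.Build _ _ _ _ W mW).
Let ZWfun w := (Z w, W w).
Let mZW : measurable_fun setT ZWfun.
Proof. exact: measurable_fun_pair. Qed.
Let ZWf : {mfun T >-> (R * R)%type} :=
  HB.pack ZWfun (isMeasurableFun.Build _ _ _ _ ZWfun mZW).

(** The joint law of an independent pair is the product of its marginals, so
    this is Fubini's theorem. *)
Lemma expectation_prod_independent (f g : R -> R) :
  measurable_fun setT f -> measurable_fun setT g ->
  (forall x, `|f x| <= 1) -> (forall x, `|g x| <= 1) ->
  \int[P]_w (f (Z w) * g (W w)) =
  (\int[P]_w f (Z w)) * (\int[P]_w g (W w)).
Proof.
move=> mf mg f1 g1.
have bint d' (T' : measurableType d') (Q : probability T' R) (h : T' -> R) :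
    measurable_fun setT h -> (forall x, `|h x| <= 1) ->
    Q.-integrable setT (EFin \o h).
  move=> mh h1; apply: measurable_bounded_integrable => //.
    by rewrite (le_lt_trans (probability_le1 _ _))// ltry.
  by exists 1; split => // M M1 x _ /=; rewrite (le_trans (h1 x))// ltW.
have law (f0 : R -> R) (Y : {mfun T >-> R}) : measurable_fun setT f0 ->
    (forall x, `|f0 x| <= 1) ->
    \int[P]_w f0 (Y w) = \int[distribution P Y]_x f0 x.
  move=> mf0 f01; rewrite /Rintegral; congr fine.
  rewrite (@integral_distribution _ _ _ _ _ _ Y (EFin \o f0))//.
  - exact/measurable_EFinP.
  - by apply: (bint _ _ P) => //; exact: measurableT_comp.
rewrite (law f Zf)// (law g Wf)//.
set m1 := distribution P Zf; set m2 := distribution P Wf.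
pose h (z : R * R) := f z.1 * g z.2.
have mh : measurable_fun setT h.
  by apply: measurable_funM; apply: measurableT_comp.
have h1 z : `|h z| <= 1 by rewrite normrM mulr_ile1.
have -> : \int[P]_w (f (Z w) * g (W w)) = fine (\int[distribution P ZWf]_z (h z)%:E)%E.
  rewrite (@integral_distribution _ _ _ _ _ _ ZWf (EFin \o h))//.
  - exact/measurable_EFinP.
  - apply: (bint _ _ P (fun w => h (Z w, W w))) => //.
    by apply: (@measurableT_comp _ _ _ _ _ _ h).
have -> : (\int[distribution P ZWf]_z (h z)%:E = \int[(m1 \x m2)%E]_z (h z)%:E)%E.
  apply: eq_measure_integral => D mD _.
  exact/esym/(product_measure_unique (m' := distribution P ZWf)).
rewrite -integral12_prod_meas1; last first.
  by apply: (bint _ _ (m1 \x m2)%E).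
rewrite /fubini_F /=.
under eq_integral => x _.
  rewrite (_ : (fun y => _) = (fun y => (f x)%:E * (g y)%:E)%E)//.
  rewrite integralZl//; last exact: (bint _ _ m2).
  rewrite -[(\int[m2]_x0 _)%E]fineK; last first.
    exact: integrable_fin_num (bint _ _ m2 _ _ _).
  over.
rewrite /= integralZr//; last exact: (bint _ _ m1).
by rewrite fineM//; exact: integrable_fin_num (bint _ _ m1 _ _ _).
Qed.

(** [U] and [V] stand for any variables with the laws of [Z] and [W]: this
    freedom is what compares the joint laws of two different pairs. *)
Lemma joint_lawE (U V : {mfun T >-> R}) (D : set (R * R)) :
  identically_distributed P Z U -> identically_distributed P W V ->
  measurable D ->
  (distribution P U \x distribution P V)%E D = P [set w | D (Z w, W w)].
Proof.
move=> ZU WV mD.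
rewrite (@product_measure_unique _ _ _ _ _ _ _ (distribution P ZWf))//.
by move=> A B mA mB; rewrite -[RHS]/(P _ * P _)%E -ZU// -WV//; exact: ZW.
Qed.

End joint_law.
Lemma joint_law_unique (Z W U V : T -> R) (D : set (R * R)) :
  measurable_fun setT Z -> measurable_fun setT W ->
  measurable_fun setT U -> measurable_fun setT V ->
  independent_pair Z W -> independent_pair U V ->
  identically_distributed P Z U -> identically_distributed P W V ->
  measurable D -> P [set w | D (Z w, W w)] = P [set w | D (U w, V w)].
Proof.
move=> mZ mW mU mV ZW UV ZU WV mD.
pose Uf : {mfun T >-> R} := HB.pack U (isMeasurableFun.Build _ _ _ _ U mU).
pose Vf : {mfun T >-> R} := HB.pack V (isMeasurableFun.Build _ _ _ _ V mV).
rewrite -(@joint_lawE Z W mZ mW ZW Uf Vf)//.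
by rewrite -(@joint_lawE U V mU mV UV Uf Vf).
Qed.

End independence.

(** * Cylinder events and the zero-one law *)

Section cylinders.
Context {d : measure_display} {T : measurableType d} {R : realType}.
Variables (P : probability T R) (X : nat -> {RV P >-> R}).

(** Cylinders are intersections over all indices of events that are trivial off
    [D] and beyond some rank.  Compared with intersections over finite index
    sets, this makes the intersection of two cylinders a pointwise one. *)
Definition cylinders (D : set nat) : set (set T) :=
  [set C | exists (A : nat -> set R) (n : nat),
    [/\ forall i, measurable (A i),
        forall i, ~ D i \/ (n <= i)%N -> A i = setT &
        C = \bigcap_i (X i @^-1` A i)]].

Lemma cylinders_measurable D : cylinders D `<=` measurable.
Proof.
move=> _ [A [n [mA _ ->]]]; apply: bigcap_measurable => // i _.
exact: measurable_funPTI.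
Qed.

Lemma cylindersT D : cylinders D setT.
Proof.
by exists (fun=> setT), 0%N; split=> //; apply/seteqP; split.
Qed.

Lemma cylindersI D : setI_closed (cylinders D).
Proof.
move=> _ _ [A [n [mA hA ->]]] [B [m [mB hB ->]]].
exists (fun i => A i `&` B i), (maxn n m); split.
- by move=> i; exact: measurableI.
- move=> i [Di|]; first by rewrite hA ?hB ?setTI//; left.
  by rewrite geq_max => /andP[ni mi]; rewrite hA ?hB ?setTI//; right.
- by rewrite -bigcapI.
Qed.

Lemma cylinders_preimage D i (A : set R) : D i -> measurable A ->
  cylinders D (X i @^-1` A).
Proof.
move=> Di mA; exists (fun j => if j == i then A else setT), i.+1; split.
- by move=> j; case: ifP.
- by move=> j; case: eqP => // ->; rewrite ltnn => -[].
- apply/seteqP; split => w /= Aw; last by have := Aw i I; rewrite eqxx.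
  by move=> j _; case: eqP => // ->.
Qed.

Lemma cylinders_sub D D' : D `<=` D' -> cylinders D `<=` cylinders D'.
Proof.
move=> DD' _ [A [n [mA hA ->]]]; exists A, n; split => // i hi.
by apply: hA; case: hi => [nD'|]; [left => /DD'|right].
Qed.

Lemma cylinders_bounded D C : cylinders D C -> exists n, cylinders `I_n C.
Proof.
move=> [A [n [mA hA ->]]]; exists n, A, n; split => // i hi.
by apply: hA; right; case: hi => //= /negP; rewrite -leqNgt.
Qed.

Hypothesis X_indep : mutually_independent X.

Lemma probability_cylinder (A : nat -> set R) n :
  (forall i, measurable (A i)) -> (forall i, (n <= i)%N -> A i = setT) ->
  (P (\bigcap_i (X i @^-1` A i)) = \prod_(i < n) P (X i @^-1` A i))%E.
Proof.
move=> mA hA; pose J := [fset i | i in iota 0 n]%fset.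
have JE i : (i \in J) = (i < n)%N by rewrite in_fset /= mem_iota.
transitivity (P (\bigcap_(i in [set` J]) (X i @^-1` A i))).
  congr (P _); apply/seteqP; split => w /= Aw i; first by move=> _; exact: Aw.
  move=> _; have [ni|ni] := leqP n i; first by rewrite hA.
  by apply: Aw; rewrite /= JE.
rewrite (X_indep J mA) -(big_mkord xpredT (fun i => P (X i @^-1` A i))).
apply: perm_big; apply: uniq_perm; rewrite ?fset_uniq ?iota_uniq//.
by move=> i; rewrite JE mem_index_iota.
Qed.

(** For each index one of the two constraints is trivial, so the product rule
    for the intersection splits factor by factor. *)
Lemma independent_cylinders D D' : [disjoint D & D'] ->
  forall C C', cylinders D C -> cylinders D' C' ->
  (P (C `&` C') = P C * P C')%E.
Proof.
move=> /disj_setPS DD' _ _ [A [n [mA hA ->]]] [B [m [mB hB ->]]].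
have hA' i : (maxn n m <= i)%N -> A i = setT.
  by rewrite geq_max => /andP[ni _]; apply: hA; right.
have hB' i : (maxn n m <= i)%N -> B i = setT.
  by rewrite geq_max => /andP[_ mi]; apply: hB; right.
rewrite (probability_cylinder mA hA') (probability_cylinder mB hB').
rewrite -big_split -bigcapI /=.
under eq_bigcapr do rewrite -preimage_setI.
rewrite (@probability_cylinder (fun i => A i `&` B i) (maxn n m)).
- apply: eq_bigr => i _; have [Di|Di] := pselect (D i).
    rewrite (hB i); last by left => D'i; exact: (DD' i).
    by rewrite setIT preimage_setT probability_setT mule1.
  by rewrite (hA i) ?setTI ?preimage_setT ?probability_setT ?mul1e//; left.
- by move=> i; exact: measurableI.
- by move=> i hi; rewrite hA' ?hB' ?setTI.
Qed.

Lemma independent_disjoint D D' : [disjoint D & D'] ->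
  forall E E', <<s cylinders D >> E -> <<s cylinders D' >> E' ->
  (P (E `&` E') = P E * P E')%E.
Proof.
move=> DD'; apply: independent_generated.
- exact: cylinders_measurable.
- exact: cylinders_measurable.
- exact: cylindersI.
- exact: cylindersI.
- exact: cylindersT.
- exact: cylindersT.
- exact: independent_cylinders.
Qed.

(** A tail event is independent of every cylinder, since a cylinder involves
    finitely many indices only; hence it is independent of the sigma-algebra
    they generate, which contains it. *)
Lemma kolmogorov_zero_one E :
  (forall n, <<s cylinders [set i | (n <= i)%N] >> E) -> P E = 0%E \/ P E = 1%E.
Proof.
move=> tailE.
have sE : <<s cylinders setT >> E.
  suff: <<s cylinders [set i | (0 <= i)%N] >> `<=` <<s cylinders setT >> by exact.
  apply: smallest_sub; first exact: smallest_sigma_algebra.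
  by apply: subset_trans (@sub_gen_smallest _ _ _); exact: cylinders_sub.
have mE : measurable E.
  suff: <<s cylinders setT >> `<=` @measurable _ T by exact.
  apply: smallest_sub; first exact: sigma_algebra_measurable.
  exact: cylinders_measurable.
have : (P (E `&` E) = P E * P E)%E.
  apply: (@independent_generated _ _ _ P (cylinders setT) [set E; setT]).
  - exact: cylinders_measurable.
  - by move=> _ [] ->.
  - exact: cylindersI.
  - by move=> _ _ [] -> [] ->; rewrite ?setIT ?setTI ?setIid; [left|left|left|right].
  - exact: cylindersT.
  - by right.
  - move=> C _ HC [] ->; last by rewrite setIT probability_setT mule1.
    have [n Cn] := cylinders_bounded HC.
    apply: (@independent_disjoint `I_n [set i | (n <= i)%N]) => //.
      by apply/disj_setPS => i /= [] /[swap] /leq_ltn_trans/[apply]; rewrite ltnn.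
    exact: sub_gen_smallest.
  - exact: sE.
  - by apply: sub_gen_smallest; left.
rewrite setIid -[P E]fineK ?fin_num_measure// -EFinM => -[].
move=> /eqP; rewrite -subr_eq0 -[X in X - _]mulr1 -mulrBr mulf_eq0 => /orP[/eqP->|].
  by left.
by rewrite subr_eq0 => /eqP <-; right.
Qed.

End cylinders.

(** * Symmetric laws and bounded expectations *)

Section symmetric_laws.
Context {d : measure_display} {T : measurableType d} {R : realType}.
Variable P : probability T R.

Lemma integrable_bounded (M : R) (Y : T -> R) : measurable_fun setT Y ->
  (forall w, `|Y w| <= M) -> P.-integrable setT (EFin \o Y).
Proof.
move=> mY YM; apply: measurable_bounded_integrable => //.
  by rewrite (le_lt_trans (probability_le1 _ _))// ltry.
exists M; split; first exact: num_real.
by move=> K MK x _ /=; rewrite (le_trans (YM x))// ltW.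
Qed.

Lemma expectation_cst (r : R) : \int[P]_w r = r.
Proof.
rewrite Rintegral_cst// -[RHS]mulr1; congr (_ * _).
exact (f_equal (@fine R) (probability_setT P)).
Qed.

Lemma measurable_cos : measurable_fun setT (@cos R).
Proof. by apply: continuous_measurable_fun => x; exact: continuous_cos. Qed.

Lemma measurable_sin : measurable_fun setT (@sin R).
Proof. by apply: continuous_measurable_fun => x; exact: continuous_sin. Qed.

Lemma normr_cos_le1 (x : R) : `|cos x| <= 1.
Proof. by rewrite ler_norml cos_le1 cos_geN1. Qed.

Lemma normr_sin_le1 (x : R) : `|sin x| <= 1.
Proof. by rewrite ler_norml sin_le1 sin_geN1. Qed.

Lemma integrable_cos (Y : T -> R) : measurable_fun setT Y ->
  P.-integrable setT (EFin \o (fun w => cos (Y w))).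
Proof.
move=> mY; apply: (@integrable_bounded 1); last by move=> w; exact: normr_cos_le1.
by apply: measurableT_comp => //; exact: measurable_cos.
Qed.

Lemma integrable_sin (Y : T -> R) : measurable_fun setT Y ->
  P.-integrable setT (EFin \o (fun w => sin (Y w))).
Proof.
move=> mY; apply: (@integrable_bounded 1); last by move=> w; exact: normr_sin_le1.
by apply: measurableT_comp => //; exact: measurable_sin.
Qed.

Lemma expectation_identically_distributed (Y Z : T -> R) (f : R -> R) :
  measurable_fun setT Y -> measurable_fun setT Z -> measurable_fun setT f ->
  (forall x, `|f x| <= 1) -> identically_distributed P Y Z ->
  \int[P]_w f (Y w) = \int[P]_w f (Z w).
Proof.
move=> mY mZ mf f1 YZ.
pose Yf : {mfun T >-> R} := HB.pack Y (isMeasurableFun.Build _ _ _ _ Y mY).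
pose Zf : {mfun T >-> R} := HB.pack Z (isMeasurableFun.Build _ _ _ _ Z mZ).
have law (V : {mfun T >-> R}) :
    (\int[P]_w (f (V w))%:E = \int[distribution P V]_x (f x)%:E)%E.
  rewrite (@integral_distribution _ _ _ _ _ _ V (EFin \o f))//.
    exact/measurable_EFinP.
  by apply: (@integrable_bounded 1) => //; exact: measurableT_comp.
rewrite /Rintegral; congr fine; rewrite (law Yf) (law Zf).
by apply: eq_measure_integral => A mA _; exact: YZ.
Qed.

Definition symmetric_law (Y : T -> R) := identically_distributed P Y (\- Y).

Lemma expectation_sin_symmetric (Y : T -> R) : measurable_fun setT Y ->
  symmetric_law Y -> \int[P]_w sin (Y w) = 0.
Proof.
move=> mY sY; have mNY : measurable_fun setT (\- Y) by exact: measurableT_comp.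
have := expectation_identically_distributed mY mNY measurable_sin normr_sin_le1 sY.
under [RHS]eq_Rintegral do rewrite /= sinN -mulN1r.
rewrite RintegralZl//; last exact: integrable_sin.
by set e := (\int[P]_w _) => ?; lra.
Qed.

Lemma symmetric_law_identically_distributed (Y Z : T -> R) :
  identically_distributed P Z Y -> symmetric_law Y -> symmetric_law Z.
Proof.
move=> ZY sY A mA; rewrite ZY// sY// -[RHS]/(P (Z @^-1` (-%R @^-1` A))) ZY//.
by rewrite -[X in measurable X]setTI; exact: oppr_measurable.
Qed.

Lemma symmetric_lawZ (r : R) (Y : T -> R) :
  symmetric_law Y -> symmetric_law (fun w => r * Y w).
Proof.
move=> sY A mA.
have mrA : measurable ((fun x => r * x) @^-1` A).
  by rewrite -[X in measurable X]setTI; exact: measurable_funM.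
rewrite -[LHS]/(P (Y @^-1` ((fun x => r * x) @^-1` A))) sY//; congr (P _).
by apply/seteqP; split => w /=; rewrite mulrN.
Qed.

(** The pairs (Z, W) and (-Z, -W) have the same joint law, which is determined
    by the marginals. *)
Lemma symmetric_lawD (Z W : T -> R) :
  measurable_fun setT Z -> measurable_fun setT W -> independent_pair P Z W ->
  symmetric_law Z -> symmetric_law W -> symmetric_law (Z \+ W).
Proof.
move=> mZ mW ZW sZ sW A mA.
have mNZ : measurable_fun setT (\- Z) by exact: measurableT_comp.
have mNW : measurable_fun setT (\- W) by exact: measurableT_comp.
have NZW : independent_pair P (\- Z) (\- W).
  move=> B C mB mC; rewrite -sZ// -sW//.
  have -> : (\- Z) @^-1` B = Z @^-1` (-%R @^-1` B) by [].
  have -> : (\- W) @^-1` C = W @^-1` (-%R @^-1` C) by [].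
  have mN (D : set R) : measurable D -> measurable (-%R @^-1` D).
    by move=> mD; rewrite -[X in measurable X]setTI; exact: oppr_measurable.
  rewrite ZW; [|exact: mN|exact: mN].
  have -> : P (Z @^-1` (-%R @^-1` B)) = P (Z @^-1` B) by rewrite (sZ _ mB).
  by have -> : P (W @^-1` (-%R @^-1` C)) = P (W @^-1` C) by rewrite (sW _ mC).
have -> : (\- (Z \+ W)) @^-1` A =
    [set w | [set z : R * R | A (z.1 + z.2)] ((\- Z) w, (\- W) w)].
  by apply/seteqP; split => w /=; rewrite opprD.
have mD : measurable [set z : R * R | A (z.1 + z.2)].
  rewrite -[X in measurable X]setTI.
  by apply: (@measurable_funD _ _ _ setT fst snd).
exact: (joint_law_unique mZ mW mNZ mNW ZW NZW sZ sW mD).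
Qed.
End symmetric_laws.

(** * Weighted sums of independent variables *)

Section weighted_sums.
Context {d : measure_display} {T : measurableType d} {R : realType}.
Variables (P : probability T R) (X : nat -> {RV P >-> R}).
Hypothesis X_indep : mutually_independent X.
Implicit Type v : nat -> R.

Definition weighted_sum v n (w : T) : R := \sum_(i < n) v i * X i w.

Lemma weighted_sumS v n w :
  weighted_sum v n.+1 w = weighted_sum v n w + v n * X n w.
Proof. by rewrite /weighted_sum big_ord_recr. Qed.

Lemma measurable_weighted_sum v n : measurable_fun setT (weighted_sum v n).
Proof.
by apply: measurable_sum => i; exact: measurable_funM.
Qed.

Lemma generated_measurable_sum (D : set nat) v (s : seq nat) :
  {in s, forall i, D i} -> measurable_fun setT
    ((fun w => \sum_(i <- s) v i * X i w)
       : g_sigma_algebraType (cylinders X D) -> R).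
Proof.
elim: s => [|i s IH] sD.
  by under eq_fun do rewrite big_nil; exact: measurable_cst.
under eq_fun do rewrite big_cons; apply: measurable_funD.
  apply: measurable_funM => //.
  move=> _ A mA; rewrite setTI; apply: sub_gen_smallest.
  by apply: cylinders_preimage => //; apply: sD; rewrite mem_head.
by apply: IH => j js; apply: sD; rewrite in_cons js orbT.
Qed.

Lemma independent_weighted_sum v n :
  independent_pair P (weighted_sum v n) (fun w => v n * X n w).
Proof.
move=> A B mA mB.
apply: (@independent_disjoint _ _ _ P X X_indep `I_n [set n]).
- by apply/disj_setPS => i /= [/[swap] ->]; rewrite ltnn.
- rewrite -[X in <<s _ >> X]setTI.
  rewrite (_ : weighted_sum v n = fun w => \sum_(i <- iota 0 n) v i * X i w).
    apply: (@generated_measurable_sum `I_n) => // i.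
    by rewrite mem_iota.
  apply/funext => w; rewrite /weighted_sum.
  by rewrite -(big_mkord xpredT (fun i => v i * X i w)) /index_iota subn0.
- rewrite -[X in <<s _ >> X]setTI.
  rewrite (_ : (fun w => _) = fun w => \sum_(i <- [:: n]) v i * X i w).
    by apply: (@generated_measurable_sum [set n]) => // i; rewrite inE => /eqP.
  by apply/funext => w; rewrite big_seq1.
Qed.

Lemma symmetric_weighted_sum v n : (forall i, symmetric_law P (X i)) ->
  symmetric_law P (weighted_sum v n).
Proof.
move=> sX; elim: n => [|n IH].
  move=> A mA; congr (P _); apply/seteqP.
  by split => w /=; rewrite /weighted_sum big_ord0 oppr0.
rewrite (_ : weighted_sum v n.+1 = weighted_sum v n \+ (fun w => v n * X n w)).
  apply: symmetric_lawD => //.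
  - exact: measurable_weighted_sum.
  - exact: measurable_funM.
  - exact: independent_weighted_sum.
  - exact: symmetric_lawZ.
by apply/funext => w; rewrite weighted_sumS.
Qed.

(** Addition formula for cos: the product of the two sine expectations vanishes
    by symmetry. *)
Lemma expectation_cos_weighted_sum v n (Y : {RV P >-> R}) (t : R) :
  (forall i, identically_distributed P (X i) Y) -> symmetric_law P Y ->
  \int[P]_w cos (t * weighted_sum v n w) =
  \prod_(i < n) \int[P]_w cos (t * v i * Y w).
Proof.
move=> XY sY.
have sX i : symmetric_law P (X i).
  exact: symmetric_law_identically_distributed (XY i) sY.
elim: n => [|n IH].
  rewrite big_ord0; under eq_Rintegral do rewrite /weighted_sum big_ord0 mulr0 cos0.
  exact: expectation_cst.
rewrite big_ord_recr /= -IH.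
under eq_Rintegral do rewrite weighted_sumS mulrDr mulrA cosD.
have mS := measurable_weighted_sum v n.
have mtS : measurable_fun setT (fun w => t * weighted_sum v n w).
  exact: measurable_funM.
have mtX : measurable_fun setT (fun w => t * v n * X n w).
  exact: measurable_funM.
have ind : independent_pair P (weighted_sum v n) (X n).
  move=> A B mA mB.
  (* the last weight is set to 1, as [v n] may vanish *)
  have := independent_weighted_sum (fun i => if i == n then 1 else v i) n mA mB.
  rewrite (_ : weighted_sum _ n = weighted_sum v n) ?eqxx; last first.
    apply/funext => w; apply: eq_bigr => i _.
    by rewrite ltn_eqF.
  by rewrite (_ : (fun w => _) = X n)//; apply/funext => w; rewrite mul1r.
have mcos (u : R) : measurable_fun setT (fun x : R => cos (u * x)).
  by apply: measurableT_comp; [exact: measurable_cos|exact: measurable_funM].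
have msin (u : R) : measurable_fun setT (fun x : R => sin (u * x)).
  by apply: measurableT_comp; [exact: measurable_sin|exact: measurable_funM].
rewrite RintegralB//.
- rewrite (expectation_prod_independent mS _ ind (mcos t) (mcos (t * v n)))//;
    try by move=> ?; exact: normr_cos_le1.
  rewrite (expectation_prod_independent mS _ ind (msin t) (msin (t * v n)))//;
    try by move=> ?; exact: normr_sin_le1.
  rewrite (expectation_sin_symmetric mtS) ?mul0r ?subr0.
    congr (_ * _).
    apply: (expectation_identically_distributed
      (f := fun x => cos (t * v n * x))) => // x.
    exact: normr_cos_le1.
  by apply: symmetric_lawZ => //; exact: symmetric_weighted_sum.
- apply: (@integrable_bounded _ _ _ P 1).
    by apply: measurable_funM; apply: measurableT_comp => //; exact: measurable_cos.
  by move=> w; rewrite normrM mulr_ile1// normr_cos_le1.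
- apply: (@integrable_bounded _ _ _ P 1).
    by apply: measurable_funM; apply: measurableT_comp => //; exact: measurable_sin.
  by move=> w; rewrite normrM mulr_ile1// normr_sin_le1.
Qed.

End weighted_sums.

(** * Subadditive functions controlled along a slowly decreasing sequence *)

Section subadditive_modulus.
Context {R : realType}.
Variables (q : R -> R) (beta : R) (s : nat -> R).
Hypothesis beta_gt0 : 0 < beta.
Hypothesis q_subadd : forall x y, q (x + y) <= q x + q y.
Hypothesis q_cvg0 : q x @[x --> 0] --> 0.
Hypothesis s_gt0 : forall n, 0 < s n.
Hypothesis s_cvg0 : s n @[n --> \oo] --> 0.
Hypothesis s_slow : forall eta, 0 < eta ->
  exists N, forall n, (N <= n)%N -> (1 - eta) * s n <= s n.+1.

Let powR_le (x y : R) : 0 <= x -> x <= y -> x `^ beta <= y `^ beta.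
Proof.
by move=> x0 xy; rewrite ge0_ler_powR ?nnegrE ?(ltW beta_gt0)// (le_trans x0 xy).
Qed.

Let s_small (e : R) : 0 < e -> exists N, forall n, (N <= n)%N -> s n <= e.
Proof.
move=> e0; have /cvgrPdist_le/(_ e e0)[N _ sN] := s_cvg0.
by exists N => n /sN /=; rewrite sub0r normrN (ger0_norm (ltW (s_gt0 n))).
Qed.

Lemma bracket_null_sequence (N : nat) (x : R) : 0 < x -> x <= s N ->
  exists2 n, (N <= n)%N & s n.+1 <= x <= s n.
Proof.
move=> x0 xN.
have [M sM] := s_small x0.
have ex : exists n, (N <= n)%N && (s n.+1 <= x).
  by exists (maxn N M); rewrite leq_maxl sM// leqW// leq_maxr.
case: (ex_minnP ex) => n /andP[Nn snx] nmin; exists n => //.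
rewrite snx /=; move: Nn; rewrite leq_eqVlt => /predU1P[<-//|Nn].
case: n => // n in snx nmin Nn *.
rewrite leNgt; apply/negP => snx'.
by have := nmin n; rewrite -ltnS Nn (ltW snx') => /(_ isT); rewrite ltnn.
Qed.

(** Greedy expansion: x exceeds the bracketing term s_(n+1) by at most x / 2,
    so that g = q - K (.)^beta satisfies g(x) <= g(r) for some r <= x / 2.
    Iterating, r tends to 0 and q(r) with it, whence g(x) <= 0. *)
Lemma subadditive_upper (C : R) (N0 : nat) :
  (forall n, (N0 <= n)%N -> q (s n) <= C * s n `^ beta) ->
  exists2 K, 0 < K & exists2 del, 0 < del &
    forall x, 0 <= x -> x <= del -> q x <= K * x `^ beta.
Proof.
move=> qC.
have [N1 hN1] : exists N, forall n, (N <= n)%N -> (1 - 2^-1) * s n <= s n.+1.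
  by apply: s_slow; lra.
pose N := maxn N0 N1.
have s2 n : (N <= n)%N -> s n <= 2 * s n.+1.
  by rewrite geq_max => /andP[_ /hN1]; lra.
have qN n : (N <= n)%N -> q (s n) <= C * s n `^ beta.
  by rewrite geq_max => /andP[/qC].
pose rho : R := 2^-1 `^ beta.
have rho_lt1 : rho < 1.
  have := @gt0_ltr_powR R beta beta_gt0 (2^-1) 1.
  by rewrite /rho powR1 !nnegrE => -> //; lra.
have rho_ge0 : 0 <= rho by exact: powR_ge0.
(* K is chosen so that |C| + K rho <= K; the term 1 makes it positive. *)
pose K := `|C| / (1 - rho) + 1.
have K0 : 0 < K.
  by rewrite ltr_wpDl// divr_ge0// subr_ge0 ltW.
have CK : `|C| <= K * (1 - rho).
  rewrite mulrDl divfK ?mul1r; last by rewrite subr_eq0 eq_sym lt_eqF.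
  by rewrite lerDl subr_ge0 ltW.
exists K => //; exists (s N) => //.
have step x : 0 <= x -> x <= s N -> exists r, [/\ 0 <= r, r <= x / 2 &
    q x - K * x `^ beta <= q r - K * r `^ beta].
  rewrite le_eqVlt => /predU1P[<- _|x0 xN].
    by exists 0; split => //; rewrite mul0r.
  have [m Nm /andP[snx xsm]] := bracket_null_sequence x0 xN.
  have := s2 m Nm; move: snx; set n := m.+1 => snx smn.
  exists (x - s n); split; [by rewrite subr_ge0|lra|].
  have h1 : q x <= q (s n) + q (x - s n).
    by apply: le_trans (q_subadd _ _); rewrite subrKC.
  have h2 : q (s n) <= C * s n `^ beta by apply: qN; exact: leqW.
  have h3 : s n `^ beta <= x `^ beta by apply: powR_le => //; exact/ltW.
  have h4 : (x - s n) `^ beta <= rho * x `^ beta.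
    rewrite -powRM; [|lra|lra]; apply: powR_le; lra.
  have h5 : 0 <= s n `^ beta by exact: powR_ge0.
  have h6 : C * s n `^ beta <= `|C| * x `^ beta.
    rewrite (le_trans (ler_wpM2r h5 (ler_norm C)))//.
    by rewrite ler_wpM2l.
  have h7 : K * (x - s n) `^ beta <= K * (rho * x `^ beta).
    by rewrite ler_wpM2l// ltW.
  have h8 : (`|C| + K * rho) * x `^ beta <= K * x `^ beta.
    by rewrite ler_wpM2r ?powR_ge0//; lra.
  lra.
have iter_step x k : 0 <= x -> x <= s N -> exists r, [/\ 0 <= r, r <= x / 2 ^+ k &
    q x - K * x `^ beta <= q r - K * r `^ beta].
  move=> x0 xN; elim: k => [|k [r [r0 rx rq]]].
    by exists x; split => //; rewrite expr0 divr1.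
  have [|r' [r'0 r'r r'q]] := step r r0.
    rewrite (le_trans rx)// (le_trans _ xN)// ler_pdivrMr ?exprn_gt0//.
    by rewrite ler_peMr// exprn_ege1// ler1n.
  exists r'; split => //; last exact: le_trans r'q.
  rewrite (le_trans r'r)// exprSr invfM mulrA ler_wpM2r// invr_ge0.
move=> x x0 xN; rewrite -subr_le0; apply/ler_addgt0Pr => e e0; rewrite add0r.
have /cvgrPdist_le/(_ e e0)/nbhs_norm0P[del /= del0 hdel] := q_cvg0.
have [k hk] : exists k : nat, x / 2 ^+ k < del.
  have := @cvg_expr R 2^-1; rewrite ger0_norm; last by lra.
  have hl : 2^-1 < 1 :> R by lra.
  have e1 : 0 < del / (x + 1) by rewrite divr_gt0// ltr_wpDl.
  move=> /(_ hl)/cvgrPdist_lt/(_ _ e1)[k _ /(_ k (leqnn _))].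
  rewrite sub0r normrN ger0_norm; last by rewrite exprn_ge0// invr_ge0.
  rewrite ltr_pdivlMr ?ltr_wpDl// => hk; exists k.
  rewrite (le_lt_trans _ hk)// exprVn mulrC ler_wpM2l ?invr_ge0 ?exprn_ge0//.
  by rewrite lerDl.
have [r [r0 rx rq]] := iter_step x k x0 xN.
rewrite (le_trans rq)// (@le_trans _ _ (q r))//.
  by rewrite gerBl mulr_ge0 ?powR_ge0// ltW.
have /hdel /= : `|r| < del by rewrite ger0_norm// (le_lt_trans rx).
by rewrite sub0r normrN; exact/le_trans/ler_norm.
Qed.

(** If s_(n+1) <= x <= s_n, then q(s_n) <= q(x) + q(s_n - x), where s_n - x is a
    small fraction of s_n: by the upper bound, the last term is at most half
    of the lower bound for q(s_n). *)
Lemma subadditive_lower (c C : R) (N0 : nat) : 0 < c ->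
  (forall n, (N0 <= n)%N -> c * s n `^ beta <= q (s n) <= C * s n `^ beta) ->
  exists2 k, 0 < k & exists2 del, 0 < del &
    forall x, 0 < x -> x <= del -> k * x `^ beta <= q x.
Proof.
move=> c0 cqC.
have [K K0 [del del0 qK]] : exists2 K, 0 < K & exists2 del, 0 < del &
    forall x, 0 <= x -> x <= del -> q x <= K * x `^ beta.
  by apply: (@subadditive_upper C N0) => n /cqC/andP[].
pose eta := Num.min 2^-1 ((c / (2 * K)) `^ beta^-1).
have cK : 0 < c / (2 * K) by rewrite divr_gt0// mulr_gt0.
have eta0 : 0 < eta by rewrite lt_min powR_gt0// andbT; lra.
have etaK : K * eta `^ beta <= c / 2.
  have : eta `^ beta <= c / (2 * K).
    have -> : c / (2 * K) = ((c / (2 * K)) `^ beta^-1) `^ beta.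
      by rewrite -powRrM mulVf ?powRr1 ?(ltW cK)//; exact: lt0r_neq0.
    by rewrite powR_le ?(ltW eta0)// ge_min lexx orbT.
  move=> h; apply: (le_trans (ler_wpM2l (ltW K0) h)).
  by rewrite (_ : K * _ = c / 2)//; field; exact: lt0r_neq0.
have [N1 hN1] := s_slow eta0.
have [N2 hN2] := s_small del0.
pose N := maxn N0 (maxn N1 N2).
have sN : s N <= del by apply: hN2; rewrite !leq_max leqnn !orbT.
exists (c / 2); first by rewrite divr_gt0.
exists (s N) => // x x0 xN.
have [n + /andP[sn1x xsn]] := bracket_null_sequence x0 xN.
rewrite !geq_max => /and3P[N0n N1n N2n].
have snd : s n - x <= eta * s n by have := hN1 n N1n; lra.
have /andP[cq _] := cqC n N0n.
have h1 : q (s n) <= q x + q (s n - x).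
  by apply: le_trans (q_subadd _ _); rewrite subrKC.
have h2 : q (s n - x) <= K * (s n - x) `^ beta.
  by apply: qK; [rewrite subr_ge0|have := hN2 n N2n; lra].
have h3 : K * (s n - x) `^ beta <= K * (eta `^ beta * s n `^ beta).
  rewrite ler_pM2l// -powRM ?(ltW eta0) ?(ltW (s_gt0 n))//.
  by apply: powR_le => //; rewrite subr_ge0.
have h4 : K * eta `^ beta * s n `^ beta <= c / 2 * s n `^ beta.
  by rewrite ler_wpM2r ?powR_ge0.
have h5 : c / 2 * x `^ beta <= c / 2 * s n `^ beta.
  by rewrite ler_pM2l ?divr_gt0// powR_le// ltW.
lra.
Qed.

End subadditive_modulus.

(** * The modulus sqrt (1 - phi) of a characteristic function *)

Section quadratic_forms.
Context {R : realType}.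

(** The right-hand side is minimal at e = b / a; dividing b + r by a + r with a
    small r > 0 avoids a case distinction when a or b vanishes. *)
Lemma le_sqr_sum (a b z : R) : 0 <= a -> 0 <= b ->
  (forall e, 0 < e -> z <= (1 + e) * a ^+ 2 + (1 + e^-1) * b ^+ 2) ->
  z <= (a + b) ^+ 2.
Proof.
move=> a0 b0 ze; apply/ler_addgt0Pr => d d0.
pose r := d / (a + b + 1).
have ab0 : 0 < a + b + 1 by rewrite ltr_wpDl ?addr_ge0.
have r0 : 0 < r by rewrite divr_gt0.
have ar : 0 < a + r by rewrite ltr_wpDl.
have br : 0 < b + r by rewrite ltr_wpDl.
have := ze ((b + r) / (a + r)); rewrite divr_gt0// => /(_ isT).
rewrite invf_div => /le_trans; apply.
have h1 : (b + r) / (a + r) * a ^+ 2 <= (b + r) * a.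
  by rewrite -mulrA ler_pM2l// mulrC ler_pdivrMr// expr2 ler_wpM2l// lerDl ltW.
have h2 : (a + r) / (b + r) * b ^+ 2 <= (a + r) * b.
  by rewrite -mulrA ler_pM2l// mulrC ler_pdivrMr// expr2 ler_wpM2l// lerDl ltW.
have h3 : r * (a + b) <= d.
  by rewrite /r mulrAC ler_pdivrMr// ler_pM2l// lerDl.
have x0 : 0 <= a * b by rewrite mulr_ge0.
rewrite sqrrD !(mulrDl 1) !mul1r; lra.
Qed.

Lemma one_sub_cosE (x : R) : 1 - cos x = 2 * sin (x / 2) ^+ 2.
Proof.
have -> : cos x = cos ((x / 2) *+ 2) by congr cos; rewrite -mulr_natr divfK.
by rewrite cos_mulr2n cos2sin2; ring.
Qed.

(** After 1 - cos x = 2 sin^2 (x / 2), this is |sin (a + b)| <= |sin a| + |sin b|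
    squared, in a form that is linear in 1 - cos and thus passes to
    expectations. *)
Lemma one_sub_cosD (x y e : R) : 0 < e ->
  1 - cos (x + y) <= (1 + e) * (1 - cos x) + (1 + e^-1) * (1 - cos y).
Proof.
move=> e0; rewrite !one_sub_cosE (mulrDl x y) sinD.
set a := sin (x / 2); set b := sin (y / 2).
set ca := cos (x / 2); set cb := cos (y / 2).
have hca : ca ^+ 2 <= 1 by rewrite /ca cos2sin2 gerBl sqr_ge0.
have hcb : cb ^+ 2 <= 1 by rewrite /cb cos2sin2 gerBl sqr_ge0.
have amgm : (a * cb + ca * b) ^+ 2 <=
    (1 + e) * (a * cb) ^+ 2 + (1 + e^-1) * (ca * b) ^+ 2.
  rewrite -subr_ge0.
  rewrite (_ : _ - _ = e^-1 * (e * (a * cb) - ca * b) ^+ 2).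
    by rewrite mulr_ge0 ?sqr_ge0// invr_ge0 ltW.
  by field; exact: lt0r_neq0.
have h1 : (1 + e) * (a * cb) ^+ 2 <= (1 + e) * a ^+ 2.
  rewrite ler_wpM2l//; first lra.
  by rewrite exprMn -[leRHS]mulr1 ler_wpM2l// sqr_ge0.
have ei : 0 < e^-1 by rewrite invr_gt0.
have h2 : (1 + e^-1) * (ca * b) ^+ 2 <= (1 + e^-1) * b ^+ 2.
  rewrite ler_wpM2l//; first lra.
  by rewrite exprMn -[leRHS]mul1r ler_wpM2r// sqr_ge0.
lra.
Qed.

End quadratic_forms.

Section charfun_near0.
Context {d : measure_display} {T : measurableType d} {R : realType}.
Variables (P : probability T R) (Y : {RV P >-> R}).

(** The real part of the characteristic function, which is all of it when [Y]
    is symmetric. *)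
Definition charfun (t : R) : R := \int[P]_w cos (t * Y w).

Let mtY (t : R) : measurable_fun setT (fun w => t * Y w).
Proof. exact: measurable_funM. Qed.

Let integrable_one_sub_cos (t : R) :
  P.-integrable setT (EFin \o (fun w => 1 - cos (t * Y w))).
Proof.
apply: (@integrable_bounded _ _ _ P 2) => [|w].
  apply: measurable_funB => //; apply: measurableT_comp => //; exact: measurable_cos.
by rewrite ger0_norm ?subr_ge0 ?cos_le1//; have := cos_geN1 (t * Y w); lra.
Qed.

Lemma one_sub_charfunE t : 1 - charfun t = \int[P]_w (1 - cos (t * Y w)).
Proof.
rewrite RintegralB// ?expectation_cst//; last exact: integrable_cos.
by apply: (@integrable_bounded _ _ _ P 1) => // w; rewrite normr1.
Qed.

Lemma charfun0 : charfun 0 = 1.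
Proof.
by rewrite /charfun; under eq_Rintegral do rewrite mul0r cos0; exact: expectation_cst.
Qed.

Lemma charfun_le1 t : charfun t <= 1.
Proof.
by rewrite -subr_ge0 one_sub_charfunE Rintegral_ge0// => w _; rewrite subr_ge0 cos_le1.
Qed.

Lemma charfun_geN1 t : -1 <= charfun t.
Proof.
rewrite -subr_ge0 opprK addrC -[X in X + _](expectation_cst P) -RintegralD//.
- by apply: Rintegral_ge0 => w _; have := cos_geN1 (t * Y w); lra.
- by apply: (@integrable_bounded _ _ _ P 1) => // w; rewrite normr1.
- exact: integrable_cos.
Qed.

Lemma continuous_charfun : continuous charfun.
Proof.
move=> t; apply: (@continuity_under_integral R _ T P (fun t w => cos (t * Y w))
  setT measurableT (t - 1) (t + 1) _ _ (cst 1)).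
- by move=> x _; exact: integrable_cos.
- apply: aeW => w _ x _; apply: continuous_comp; last exact: continuous_cos.
  exact: mulrr_continuous.
- by apply: (@integrable_bounded _ _ _ P 1) => // w; rewrite normr1.
- by move=> x _; apply: aeW => w _; exact: normr_cos_le1.
- by rewrite inE /= in_itv /= ltrBlDr ltrDl ltr01.
Qed.

(** Up to the factor sqrt 2, the L^2 norm of sin (t Y / 2). *)
Definition charfun_modulus t : R := Num.sqrt (1 - charfun t).

Lemma sqr_charfun_modulus t : charfun_modulus t ^+ 2 = 1 - charfun t.
Proof. by rewrite sqr_sqrtr// subr_ge0 charfun_le1. Qed.

Lemma charfun_modulus_subadditive x y :
  charfun_modulus (x + y) <= charfun_modulus x + charfun_modulus y.
Proof.
have q0 t : 0 <= charfun_modulus t by exact: sqrtr_ge0.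
rewrite -(@ler_pXn2r _ 2)// ?nnegrE ?addr_ge0// sqr_charfun_modulus.
apply: le_sqr_sum => // e e0; rewrite !sqr_charfun_modulus !one_sub_charfunE.
have iZ r t : P.-integrable setT (EFin \o (fun w => r * (1 - cos (t * Y w)))).
  exact: (integrableZl measurableT r (integrable_one_sub_cos t)).
rewrite -!RintegralZl// -RintegralD//; apply: le_Rintegral => //.
  exact: (integrableD measurableT (iZ _ _) (iZ _ _)).
by move=> w _; rewrite mulrDl; exact: one_sub_cosD.
Qed.

Lemma charfun_modulus_cvg0 : charfun_modulus t @[t --> 0] --> 0.
Proof.
have : charfun_modulus t @[t --> 0] --> charfun_modulus 0.
  apply: (continuous_comp (f := fun t => 1 - charfun t) (g := Num.sqrt)).
    by apply: cvgB; [exact: cvg_cst|exact: continuous_charfun].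
  exact: sqrt_continuous.
by rewrite {2}/charfun_modulus charfun0 subrr sqrtr0.
Qed.

End charfun_near0.

(** * Domain of attraction and decay of the characteristic function *)

Section power_limits.
Context {R : realType}.

Lemma bernoulli_ineq (x : R) n : 0 <= x -> x <= 1 -> 1 - n%:R * (1 - x) <= x ^+ n.
Proof.
move=> x0 x1; elim: n => [|n IH]; first by rewrite mul0r subr0 expr0.
rewrite exprS -natr1.
have : x * (1 - n%:R * (1 - x)) <= x * x ^+ n by rewrite ler_wpM2l.
have : 0 <= n%:R * (1 - x) * (1 - x) by rewrite !mulr_ge0// subr_ge0.
by lra.
Qed.

(** Sandwich 1 - n (1 - x) <= x^n <= exp(-n (1 - x)). *)
Lemma defect_of_cvg_power (x : nat -> R) (l : R) :
  (forall n, 0 <= x n) -> (forall n, x n <= 1) -> 0 < l -> l < 1 ->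
  x n ^+ n @[n --> \oo] --> l ->
  exists c C N, [/\ 0 < c, 0 < C & forall n, (N <= n)%N ->
    c <= n%:R * (1 - x n) <= C].
Proof.
move=> x0 x1 l0 l1 xl.
have l2 : 0 < l / 2 by rewrite divr_gt0.
have l3 : 0 < (1 - l) / 2 by rewrite divr_gt0// subr_gt0.
have /cvgrPdist_le/(_ _ l2)[N1 _ hN1] := xl.
have /cvgrPdist_le/(_ _ l3)[N2 _ hN2] := xl.
exists ((1 - l) / 2), (- ln (l / 2)), (maxn N1 N2); split => //.
  by rewrite oppr_gt0 ln_lt0// l2; lra.
move=> n; rewrite geq_max => /andP[/hN1 /= + /hN2 /=].
rewrite !ler_distl => /andP[_ h1] /andP[h2 _].
apply/andP; split.
  have := bernoulli_ineq n (x0 n) (x1 n). lra.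
rewrite lerNr -ler_expR lnK ?posrE// (@le_trans _ _ (x n ^+ n))//; first lra.
rewrite -mulrN opprB mulrC expRM_natr lerXn2r ?nnegrE ?expR_ge0//.
have := expR_ge1Dx (x n - 1); lra.
Qed.

End power_limits.

Lemma powR_le_cancel {R : realType} (r x y : R) :
  0 < r -> 0 <= x -> 0 <= y -> x `^ r <= y `^ r -> x <= y.
Proof.
move=> r0 x0 y0; apply: contraTT; rewrite -!ltNge => yx.
by rewrite gt0_ltr_powR ?nnegrE.
Qed.

Section attraction.
Context {d : measure_display} {T : measurableType d} {R : realType}.
Variables (P : probability T R) (X : {RV P >-> R}) (X_ : nat -> {RV P >-> R}).
Hypothesis X_iid : iid_copies X X_.
Hypothesis X_sym : symmetric_law P X.
Variables (alpha : R) (mu : probability R R).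
Hypothesis alpha_gt0 : 0 < alpha.
Hypothesis mu_stable : symmetric_stable alpha mu.
Hypothesis X_attr : normal_attraction X_ alpha mu.

Let X_indep : mutually_independent X_. Proof. by case: X_iid. Qed.
Let X_law i : identically_distributed P (X_ i) X. Proof. by case: X_iid. Qed.

(** The unknown centring b_n only rotates (E cos Z_n, E sin Z_n), where Z_n is
    the normalised walk; the sum of the two squares is phi(s_n)^(2n). *)
Lemma attraction_charfun_power : exists a c : R, [/\ 0 < a, 0 < c &
  (charfun X (a * n%:R `^ alpha^-1)^-1 ^+ 2) ^+ n @[n --> \oo]
    --> expR (- c) ^+ 2].
Proof.
have [c c0 mu_c] := mu_stable.
have [a [b [a0 cvgZ]]] := X_attr.
exists a, c; split => //.
pose u n := (a * n%:R `^ alpha^-1)^-1.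
pose Z n w := (walk X_ n w - b n) / (a * n%:R `^ alpha^-1).
have mwalk n : measurable_fun setT (walk X_ n) by exact: measurable_sum.
have mZ n : measurable_fun setT (Z n).
  by apply: measurable_funM => //; exact: measurable_funB.
have [mucos musin] : \int[mu]_x cos x = expR (- c) /\ \int[mu]_x sin x = 0.
  have := mu_c 1; rewrite /char_fun normr1 powR1 mulr1 => -[<- <-].
  by split; apply: eq_Rintegral => x _; rewrite mul1r.
have cvgf (f : R -> R) : continuous f -> (forall x, `|f x| <= 1) ->
    (\int[P]_w f (Z n w)) @[n --> \oo] --> \int[mu]_x f x.
  move=> cf f1; apply: fine_cvg.
  have mf : measurable_fun setT f by exact: continuous_measurable_fun.
  rewrite [X in _ --> X](_ : _ = (\int[mu]_x (f x)%:E)%E).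
    have := cvgZ f cf; rewrite unlock; apply.
    by exists 1; split => // M M1 x _ /=; rewrite (le_trans (f1 x))// ltW.
  rewrite fineK//; apply: integrable_fin_num => //.
  exact: (@integrable_bounded _ _ _ mu 1).
have cosZ := cvgf _ (@continuous_cos R) (@normr_cos_le1 R).
have sinZ := cvgf _ (@continuous_sin R) (@normr_sin_le1 R).
rewrite mucos in cosZ; rewrite musin in sinZ.
have walkE n : walk X_ n = weighted_sum X_ (fun=> 1) n.
  by apply/funext => w; apply: eq_bigr => i _; rewrite mul1r.
have mS t n : measurable_fun setT (fun w => t * walk X_ n w).
  exact: measurable_funM.
have Ecos n : \int[P]_w cos (u n * walk X_ n w) = charfun X (u n) ^+ n.
  rewrite walkE (expectation_cos_weighted_sum X_indep _ _ _ X_law X_sym).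
  by rewrite mulr1 prodr_const card_ord.
have Esin n : \int[P]_w sin (u n * walk X_ n w) = 0.
  apply: expectation_sin_symmetric => //.
  apply: symmetric_lawZ; rewrite walkE.
  by apply: symmetric_weighted_sum => // i;
    exact: symmetric_law_identically_distributed (X_law i) X_sym.
have ZE n w : Z n w = u n * walk X_ n w - b n * u n.
  by rewrite /Z mulrBl mulrC.
have iZ (f : R -> R) (k : R) n : measurable_fun setT f -> (forall x, `|f x| <= 1) ->
    P.-integrable setT (EFin \o (fun w => k * f (u n * walk X_ n w))).
  move=> mf f1; apply: (@integrable_bounded _ _ _ P `|k|) => [|w].
    by apply: measurable_funM => //; exact: measurableT_comp.
  by rewrite normrM ler_piMr.
have icos k n := iZ _ k n (@measurable_cos R) (@normr_cos_le1 R).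
have isin k n := iZ _ k n (@measurable_sin R) (@normr_sin_le1 R).
have EZcos n : \int[P]_w cos (Z n w) = cos (b n * u n) * charfun X (u n) ^+ n.
  under eq_Rintegral do rewrite ZE cosB mulrC [X in _ + X]mulrC.
  rewrite RintegralD// ?RintegralZl ?Ecos ?Esin ?mulr0 ?addr0//.
    exact: integrable_sin.
  exact: integrable_cos.
have EZsin n : \int[P]_w sin (Z n w) = - sin (b n * u n) * charfun X (u n) ^+ n.
  under eq_Rintegral do rewrite ZE sinB mulrC [X in _ - X]mulrC.
  rewrite RintegralB// ?RintegralZl ?Ecos ?Esin ?mulr0 ?sub0r ?mulNr//.
    exact: integrable_cos.
  exact: integrable_sin.
rewrite [X in _ --> X](_ : _ = expR (- c) ^+ 2 + 0 ^+ 2); last first.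
  by rewrite expr0n addr0.
rewrite [X in X @ _ --> _](_ : _ = fun n =>
    (\int[P]_w cos (Z n w)) ^+ 2 + (\int[P]_w sin (Z n w)) ^+ 2).
  by apply: cvgD; rewrite expr2; apply: cvgM.
rewrite funeqE => n; rewrite EZcos EZsin !exprMn sqrrN -mulrDl cos2Dsin2 mul1r.
by rewrite -expr2 -!exprM mulnC.
Qed.

(** Along s_n the modulus sqrt (1 - phi) is of exact order s_n^(alpha/2), since
    s_n^alpha is a constant over n + 1; [subadditive_lower] extends the lower
    bound to all small arguments.  The sign of phi near 0, given by continuity,
    turns the estimate of 1 - phi^2 into one of 1 - phi. *)
Lemma charfun_le_expR : exists k del : R, [/\ 0 < k, 0 < del &
  forall t, 0 < t -> t <= del ->
    0 <= charfun X t /\ charfun X t <= expR (- (k * t `^ alpha))].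
Proof.
have [a [c [a0 c0 pow_cvg]]] := attraction_charfun_power.
(* shifted by one so that every term is positive *)
pose s n := (a * n.+1%:R `^ alpha^-1)^-1.
have s_gt0 n : 0 < s n by rewrite invr_gt0 mulr_gt0// powR_gt0 ltr0n.
pose kap := (a `^ alpha)^-1.
have kap0 : 0 < kap by rewrite invr_gt0 powR_gt0.
have sE n : s n `^ alpha = kap / n.+1%:R.
  rewrite /s -powR_inv1 ?(ltW (mulr_gt0 a0 (powR_gt0 _ _)))//.
  rewrite -powRrM mulN1r powRN powRM ?powR_ge0 ?ltW// -powRrM mulVf ?lt0r_neq0//.
  by rewrite powRr1// invfM.
have s_cvg0 : s n @[n --> \oo] --> 0.
  apply/cvgrPdist_le => e e0; near=> n.
  rewrite sub0r normrN (ger0_norm (ltW (s_gt0 n))).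
  apply: (powR_le_cancel alpha_gt0); [exact: ltW|exact: ltW|rewrite sE].
  rewrite ler_pdivrMr// mulrC -ler_pdivrMr ?powR_gt0//.
  rewrite -natr1 (@le_trans _ _ n%:R)// ?lerDl//.
  near: n; exact: nbhs_infty_ger.
have s_slow eta : 0 < eta ->
    exists N, forall n, (N <= n)%N -> (1 - eta) * s n <= s n.+1.
  move=> eta0; have [eta1|eta1] := leP 1 eta.
    exists 0%N => n _; rewrite (@le_trans _ _ 0) ?(ltW (s_gt0 _))//.
    by rewrite mulr_le0_ge0 ?(ltW (s_gt0 _))// subr_le0.
  pose r := (1 - eta) `^ alpha.
  have r1 : r < 1.
    have := @gt0_ltr_powR R alpha alpha_gt0 (1 - eta) 1.
    by rewrite powR1 !nnegrE; apply => //; lra.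
  have [N _ hN] : \forall n \near \oo, (1 - r)^-1 <= n%:R :> R.
    exact: nbhs_infty_ger.
  exists N => n Nn; apply: (powR_le_cancel alpha_gt0).
  - by rewrite mulr_ge0 ?(ltW (s_gt0 _))// subr_ge0 ltW.
  - exact: ltW.
  rewrite powRM ?(ltW (s_gt0 _)) ?subr_ge0 ?(ltW eta1)// !sE -/r.
  have := hN n Nn; rewrite /= -[X in X <= _]mul1r ler_pdivrMr ?subr_gt0// => h.
  rewrite ler_pdivlMr// mulrA mulrAC ler_pdivrMr// -!natr1.
  rewrite (mulrC r) -mulrA ler_pM2l//.
  have : 0 <= n%:R :> R by [].
  nra.
have [c1 [C1 [N0 [c10 C10 hN0]]]] :
    exists c C N, [/\ 0 < c, 0 < C & forall n, (N <= n)%N ->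
    c <= n%:R * (1 - charfun X (a * n%:R `^ alpha^-1)^-1 ^+ 2) <= C].
  apply: (defect_of_cvg_power _ _ _ _ pow_cvg).
  - by move=> n; exact: sqr_ge0.
  - move=> n; have := charfun_le1 X (a * n%:R `^ alpha^-1)^-1.
    by have := charfun_geN1 X (a * n%:R `^ alpha^-1)^-1; nra.
  - by rewrite exprn_gt0 ?expR_gt0.
  - by rewrite exprn_ilt1 ?expR_ge0// expR_lt1 oppr_lt0.
have [del0 del00 pos] : exists2 del, 0 < del & forall t, `|t| < del -> 0 <= charfun X t.
  have : charfun X t @[t --> 0] --> charfun X 0 by exact: continuous_charfun.
  rewrite charfun0 => /cvgrPdist_lt/(_ _ ltr01)/nbhs_norm0P[del /= del0 hdel].
  by exists del => // t /hdel /=; rewrite ltr_norml => /andP[_]; lra.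
have [N1 hN1] : exists N, forall n, (N <= n)%N -> s n < del0.
  have /cvgrPdist_lt/(_ _ del00)[N _ hN] := s_cvg0.
  by exists N => n /hN /=; rewrite sub0r normrN (ger0_norm (ltW (s_gt0 n))).
have [k k0 [del delgt0 hdel]] : exists2 k, 0 < k & exists2 del, 0 < del &
    forall x, 0 < x -> x <= del -> k * x `^ (alpha / 2) <= charfun_modulus X x.
  apply: (@subadditive_lower _ (charfun_modulus X) (alpha / 2) s _ _ _ _ _ _
    (Num.sqrt (c1 / (2 * kap))) (Num.sqrt (C1 / kap)) (maxn N0 N1)) => //.
  - by rewrite divr_gt0.
  - exact: charfun_modulus_subadditive.
  - exact: charfun_modulus_cvg0.
  - by rewrite sqrtr_gt0 divr_gt0 ?mulr_gt0.
  move=> n; rewrite geq_max => /andP[N0n N1n].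
  have /andP[h1 h2] := hN0 n.+1 (leqW N0n).
  have p0 : 0 <= charfun X (s n).
    by apply: pos; rewrite ger0_norm ?hN1// ltW.
  have p1 := charfun_le1 X (s n).
  have sqE : s n `^ (alpha / 2) = Num.sqrt (s n `^ alpha).
    by rewrite powRrM powR12_sqrt ?powR_ge0.
  rewrite -/(s n) in h1 h2.
  have ck0 : 0 <= c1 / (2 * kap) by rewrite divr_ge0 ?mulr_ge0// ltW.
  have Ck0 : 0 <= C1 / kap by rewrite divr_ge0// ltW.
  have Cks0 : 0 <= C1 / kap * s n `^ alpha by rewrite mulr_ge0// powR_ge0.
  rewrite sqE -!sqrtrM// /charfun_modulus !ler_sqrt// ?subr_ge0//.
  rewrite sE; apply/andP; split.
    rewrite (_ : c1 / (2 * kap) * _ = c1 / 2 / n.+1%:R); last first.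
      by field; rewrite nat1r pnatr_eq0 lt0r_neq0.
    rewrite !ler_pdivrMr// (le_trans h1)// mulrAC mulrC ler_pM2r//; nra.
  rewrite (_ : C1 / kap * _ = C1 / n.+1%:R); last first.
    by field; rewrite nat1r pnatr_eq0 lt0r_neq0.
  rewrite ler_pdivlMr// mulrC (le_trans _ h2)// ler_pM2l//; nra.
exists (k ^+ 2), (Num.min del (del0 / 2)); split.
- by rewrite exprn_gt0.
- by rewrite lt_min delgt0 divr_gt0.
move=> t t0; rewrite le_min => /andP[tdel tdel0]; split.
  by apply: pos; rewrite gtr0_norm//; lra.
have := hdel t t0 tdel.
rewrite -(@ler_pXn2r _ 2)// ?nnegrE ?mulr_ge0 ?powR_ge0 ?sqrtr_ge0 ?(ltW k0)//.
rewrite sqr_charfun_modulus exprMn -(powR_mulrn 2 (powR_ge0 t _)) -powRrM.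
rewrite divfK// => h.
have := expR_ge1Dx (- (k ^+ 2 * t `^ alpha)); lra.
Unshelve. all: by end_near. Qed.

End attraction.

(** * A discrete Esseen inequality *)

Section fejer.
Context {d : measure_display} {T : measurableType d} {R : realType}.
Variable P : probability T R.

Lemma expectation_sum (n : nat) (f : nat -> T -> R) :
  (forall i, P.-integrable setT (EFin \o f i)) ->
  \int[P]_w (\sum_(i < n) f i w) = \sum_(i < n) \int[P]_w f i w.
Proof.
move=> fi; elim: n => [|n IH].
  by rewrite big_ord0; under eq_Rintegral do rewrite big_ord0; exact: expectation_cst.
rewrite big_ord_recr -IH /=; under eq_Rintegral do rewrite big_ord_recr /=.
rewrite RintegralD//.
rewrite (_ : EFin \o _ = fun w => \sum_(i < n) (f i w)%:E)%E.
  by apply: integrable_sum => // i _; exact: fi.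
by apply/funext => w; rewrite /= sumEFin.
Qed.

(** (k - l) + (l - k) is |k - l|, because subtraction is truncated; each value of
    the distance is taken at most twice. *)
Lemma sum_absdiff_le (g : nat -> R) (N k : nat) : (forall m, 0 <= g m) ->
  (k < N)%N -> \sum_(l < N) g ((k - l) + (l - k))%N <= 2 * \sum_(m < N) g m.
Proof.
move=> g0 kN; rewrite -(big_mkord xpredT (fun l => g (k - l + (l - k))%N)).
rewrite (big_cat_nat (n := k)) ?(ltnW kN)//= mulr_natl mulr2n lerD//.
  rewrite big_nat_rev /= add0n.
  rewrite (eq_big_nat _ _ (F2 := fun l => g l.+1)); last first.
    move=> l /= lk; congr g; lia.
  rewrite -(big_add1 _ _ 0 k.+1 xpredT g) -(big_mkord xpredT g).
  rewrite [leRHS](big_cat_nat (n := k.+1))//= [X in X + _]big_nat_recl//.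
  rewrite big_add1 /= -addrA addrCA lerDl addr_ge0// sumr_ge0//.
rewrite -{1}(add0n k) big_addn -(big_mkord xpredT g).
rewrite (eq_big_nat _ _ (F2 := g)); last first.
  move=> l /= lk; congr g; lia.
by rewrite [leRHS](big_cat_nat (n := N - k))//= ?leq_subr// lerDl sumr_ge0.
Qed.

Lemma fejer_kernelE (theta : R) N :
  \sum_(k < N) \sum_(l < N) cos ((k%:R - l%:R) * theta) =
  (\sum_(k < N) cos (k%:R * theta)) ^+ 2 + (\sum_(k < N) sin (k%:R * theta)) ^+ 2.
Proof.
rewrite !expr2 !big_distrlr -big_split; apply: eq_bigr => k _ /=.
by rewrite -big_split; apply: eq_bigr => l _ /=; rewrite mulrBl cosB.
Qed.

Lemma cos_ge_half : exists2 kap : R, 0 < kap &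
  forall x, `|x| <= kap -> 2^-1 <= cos x.
Proof.
have : cos x @[x --> (0 : R)] --> cos (0 : R) by exact: continuous_cos.
rewrite cos0 => /cvgrPdist_le/(_ 2^-1).
rewrite invr_gt0 => /(_ (ltr0n _ _))/nbhs_norm0P[del /= del0 hdel].
exists (del / 2); first by rewrite divr_gt0.
move=> x xdel; have /hdel /= : `|x| < del by lra.
by rewrite ler_distlC => /andP[]; lra.
Qed.

(** The Fejer kernel is nonnegative, and at least N^2 / 2 at del Y when
    |Y| <= r, because all its cosines are then at least 1/2.  Its expectation
    involves E cos(m del Y) for the N^2 differences m = k - l. *)
Lemma fejer_concentration : exists2 kap : R, 0 < kap &
  forall (Y : T -> R) (N : nat) (del r : R), measurable_fun setT Y ->
    0 <= del -> (0 < N)%N -> N%:R * del * r <= kap ->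
    fine (P [set w | `|Y w| <= r]) * N%:R <=
      4 * \sum_(m < N) `|\int[P]_w cos (m%:R * del * Y w)|.
Proof.
have [kap kap0 hkap] := cos_ge_half; exists kap => // Y N del r mY del0 N0 Nr.
pose A := [set w | `|Y w| <= r].
have mA : measurable A.
  rewrite (_ : A = [set w | (fun w => `|Y w|) w <= cst r w])//.
  rewrite -[X in measurable X]setTI; apply: measurable_fun_le => //.
  exact: measurableT_comp.
pose F w := \sum_(k < N) \sum_(l < N) cos ((k%:R - l%:R) * (del * Y w)).
have icos t : P.-integrable setT (EFin \o (fun w => cos (t * (del * Y w)))).
  by apply: integrable_cos; do 2 apply: measurable_funM => //.
have isum k : P.-integrable setT
    (EFin \o (fun w => \sum_(l < N) cos ((k%:R - l%:R) * (del * Y w)))).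
  rewrite (_ : EFin \o _ =
      fun w => \sum_(l < N) (cos ((k%:R - l%:R) * (del * Y w)))%:E)%E.
    by apply: integrable_sum => // l _; exact: icos.
  by apply/funext => w; rewrite /= sumEFin.
have iF : P.-integrable setT (EFin \o F).
  rewrite (_ : EFin \o _ = fun w =>
      \sum_(k < N) (\sum_(l < N) cos ((k%:R - l%:R) * (del * Y w)))%:E)%E.
    by apply: integrable_sum => // l _; exact: isum.
  by apply/funext => w; rewrite /= sumEFin.
have F_ge w : (N%:R ^+ 2 / 2) * \1_A w <= F w.
  rewrite indicE; have [wA|wA] := boolP (w \in A); last first.
    by rewrite mulr0 /F fejer_kernelE addr_ge0 ?sqr_ge0.
  rewrite mulr1 (@le_trans _ _ (\sum_(k < N) \sum_(l < N) (2^-1 : R)))//.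
    rewrite !sumr_const !card_ord -mulrnA -[leRHS]mulr_natl.
    by rewrite natrM expr2.
  apply: ler_sum => k _; apply: ler_sum => l _; apply: hkap.
  rewrite normrM (le_trans _ Nr)// -mulrA ler_pM ?normr_ge0//.
    rewrite ler_norml; have := ltn_ord k; have := ltn_ord l.
    rewrite -!(ltr_nat R) => h1 h2.
    have h3 : 0 <= (k : nat)%:R :> R by [].
    have h4 : 0 <= (l : nat)%:R :> R by [].
    by apply/andP; split; lra.
  by rewrite normrM (ger0_norm del0) ler_wpM2l//; move: wA; rewrite inE.
have i1 : P.-integrable setT (EFin \o \1_A) by exact: integrable_indic.
have : \int[P]_w (N%:R ^+ 2 / 2 * \1_A w) <= \int[P]_w F w.
  apply: le_Rintegral => //.
  exact: (integrableZl measurableT (N%:R ^+ 2 / 2) i1).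
rewrite RintegralZl// {1}/Rintegral integral_indic// setIT.
rewrite (@expectation_sum N
  (fun k w => \sum_(l < N) cos ((k%:R - l%:R) * (del * Y w))))//.
under eq_bigr => k _ do
  rewrite (@expectation_sum N (fun l w => cos ((k%:R - l%:R) * (del * Y w))))//.
set g := fun m : nat => `|\int[P]_w cos (m%:R * del * Y w)|.
have cE (k l : nat) : \int[P]_w cos ((k%:R - l%:R) * (del * Y w)) <=
    g ((k - l) + (l - k))%N.
  rewrite (le_trans (ler_norm _))// /g le_eqVlt; apply/orP; left; apply/eqP.
  congr `| _ |; apply: eq_Rintegral => w _.
  have [kl|lk] := leqP k l.
    rewrite (eqP (_ : k - l == 0)%N) ?add0n ?subn_eq0// natrB// -cosN.
    by congr cos; ring.
  rewrite (eqP (_ : l - k == 0)%N) ?addn0 ?subn_eq0 ?(ltnW lk)// natrB ?(ltnW lk)//.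
  by congr cos; ring.
move=> h.
have h' : fine (P A) * N%:R * N%:R <= 4 * (\sum_(m < N) g m) * N%:R.
  have : \sum_(k < N) \sum_(l < N) \int[P]_w cos ((k%:R - l%:R) * (del * Y w)) <=
      \sum_(k < N) 2 * \sum_(m < N) g m.
    apply: ler_sum => k _.
    rewrite (le_trans _ (@sum_absdiff_le g N k _ _))//.
      by apply: ler_sum => l _.
    by move=> m; exact: normr_ge0.
  rewrite sumr_const card_ord -[leRHS]mulr_natl => /(le_trans h).
  by rewrite expr2; lra.
by move: h'; rewrite ler_pM2r// ltr0n.
Qed.

End fejer.

(** * Concentration of the means *)

Section power_series.
Context {R : realType}.

(** Cauchy condensation: the dyadic blocks are bounded by a geometric series of
    ratio 2^(1 - gam). *)
Lemma sum_powRN_le (gam : R) : 1 < gam ->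
  exists2 C, 0 < C & forall N, \sum_(n < N) n.+1%:R `^ (- gam) <= C.
Proof.
move=> gam1; pose rho : R := 2 `^ (1 - gam).
have rho0 : 0 < rho by exact: powR_gt0.
have rho1 : rho < 1.
  rewrite /rho /powR pnatr_eq0 /= expR_lt1.
  by rewrite pmulr_llt0 ?ln_gt0 ?ltr1n// subr_lt0.
have dyadic k : \sum_(n < 2 ^ k - 1) n.+1%:R `^ (- gam) <= (1 - rho ^+ k) / (1 - rho).
  elim: k => [|k IH].
    by rewrite expn0 subnn big_ord0 expr0 subrr mul0r.
  move: IH; rewrite -!(big_mkord xpredT (fun n => n.+1%:R `^ (- gam))) => IH.
  rewrite (big_cat_nat (n := 2 ^ k - 1)) ?leq_sub2r ?leq_exp2l//=.
  have -> : (1 - rho ^+ k.+1) / (1 - rho) = (1 - rho ^+ k) / (1 - rho) + rho ^+ k.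
    by rewrite exprS; field; rewrite subr_eq0 eq_sym lt_eqF.
  rewrite lerD//.
  have -> : rho ^+ k = \sum_(2 ^ k - 1 <= n < 2 ^ k.+1 - 1) (2 ^ k)%:R `^ (- gam).
    rewrite sumr_const_nat -[RHS]mulr_natl.
    have -> : (2 ^ k.+1 - 1 - (2 ^ k - 1) = 2 ^ k)%N.
      by rewrite expnS; have := expn_gt0 2 k; lia.
    rewrite -powR_mulrn ?powR_ge0// /rho -powRrM mulrC powRrM powR_mulrn//.
    rewrite natrX -{2}(@powRr1 _ (2 ^+ k)) ?exprn_ge0//.
    by rewrite -powRD// lt0r_neq0 ?exprn_gt0// implybT.
  rewrite big_nat [leRHS]big_nat; apply: ler_sum => n /andP[kn _].
  rewrite !powRN lef_pV2 ?posrE ?powR_gt0 ?ltr0n ?expn_gt0//.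
  rewrite ge0_ler_powR ?nnegrE//; first lra.
  by rewrite ler_nat; have := expn_gt0 2 k; lia.
exists (1 - rho)^-1; first by rewrite invr_gt0 subr_gt0.
move=> N; rewrite (@le_trans _ _ (\sum_(n < 2 ^ N - 1) n.+1%:R `^ (- gam)))//.
  rewrite -!(big_mkord xpredT (fun n => n.+1%:R `^ (- gam))).
  rewrite [leRHS](big_cat_nat (n := N))//=; last first.
    by have := ltn_expl N (isT : 1 < 2)%N; lia.
  by rewrite lerDl sumr_ge0// => i _; exact: powR_ge0.
rewrite (le_trans (dyadic N))// ler_pdivrMr ?subr_gt0// mulVf.
  by rewrite gerBl exprn_ge0// ltW.
by rewrite subr_eq0 eq_sym lt_eqF.
Qed.

(** From exp y >= (y / j)^j with j so large that sig j >= gam. *)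
Lemma expRN_le_powRN (c sig gam : R) : 0 < c -> 0 < sig ->
  exists2 C, 0 < C & forall n : nat, (0 < n)%N ->
    expR (- (c * n%:R `^ sig)) <= C * n%:R `^ (- gam).
Proof.
move=> c0 sig0.
have [j gj] : exists j : nat, gam <= sig * j.+1%:R.
  exists (Num.truncn (`|gam| / sig)).
  rewrite (le_trans (ler_norm _))// mulrC -ler_pdivrMr// ltW//.
  by rewrite truncnS_gt.
exists ((c / j.+1%:R) ^- j.+1).
  by rewrite invr_gt0 exprn_gt0// divr_gt0.
move=> n n0; have n1 : 1 <= n%:R :> R by rewrite ler1n.
have cj : 0 < (c / j.+1%:R) ^+ j.+1 by rewrite exprn_gt0// divr_gt0.
have ngam : 0 < n%:R `^ gam by rewrite powR_gt0// ltr0n.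
rewrite expRN powRN -invfM lef_pV2 ?posrE ?expR_gt0 ?mulr_gt0//.
set y := c * n%:R `^ sig.
have y0 : 0 <= y by rewrite mulr_ge0 ?powR_ge0// ltW.
have -> : expR y = expR (y / j.+1%:R) ^+ j.+1.
  by rewrite -expRM_natr divfK// pnatr_eq0.
have h1 : (y / j.+1%:R) ^+ j.+1 <= expR (y / j.+1%:R) ^+ j.+1.
  rewrite lerXn2r ?nnegrE ?expR_ge0 ?divr_ge0//.
  by rewrite (le_trans _ (expR_ge1Dx _))// lerDr.
apply: (le_trans _ h1).
rewrite /y mulrAC [leRHS]exprMn ler_wpM2l ?exprn_ge0 ?divr_ge0 ?(ltW c0)//.
rewrite -powR_mulrn ?powR_ge0// -powRrM.
by rewrite ler_powR.
Qed.

End power_series.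

Section mean_concentration.
Context {d : measure_display} {T : measurableType d} {R : realType}.
Variables (P : probability T R) (X : {RV P >-> R}) (X_ : nat -> {RV P >-> R}).
Hypothesis X_iid : iid_copies X X_.
Hypothesis X_sym : symmetric_law P X.

Lemma walk_meanE n w :
  walk_mean X_ n w = n%:R^-1 * weighted_sum X_ (fun i => (n - i)%:R) n w.
Proof.
congr (_ * _); elim: n => [|n IH].
  by rewrite big_geq// /weighted_sum big_ord0.
rewrite big_nat_recr//= IH /walk /weighted_sum !big_ord_recr /= addrA.
rewrite -big_split subSn// subnn mul1r; congr (_ + _).
apply: eq_bigr => i _; rewrite subSn ?(ltnW (ltn_ord i))//.
by rewrite -natr1 mulrDl mul1r.
Qed.

Lemma measurable_walk_mean n : measurable_fun setT (walk_mean X_ n).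
Proof.
rewrite (_ : walk_mean X_ n =
    fun w => n%:R^-1 * weighted_sum X_ (fun i => (n - i)%:R) n w).
  by apply: measurable_funM => //; exact: measurable_weighted_sum.
by apply/funext => w; exact: walk_meanE.
Qed.

Variables (alpha k del : R).
Hypotheses (alpha_gt0 : 0 < alpha) (alpha_lt1 : alpha < 1).
Hypotheses (k_gt0 : 0 < k) (del_gt0 : 0 < del).
Hypothesis charfun_decay : forall t, 0 < t -> t <= del ->
  0 <= charfun X t /\ charfun X t <= expR (- (k * t `^ alpha)).

Let A n := weighted_sum X_ (fun i => (n - i)%:R) n.

(** Since alpha < 1 and (n - i) / n <= 1, one has
    ((n - i) / n)^alpha >= (n - i) / n, and these ratios add up to (n + 1) / 2. *)
Lemma expectation_cos_cumulated_walk_le (n : nat) (t : R) : 0 < t -> t * n%:R <= del ->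
  `|\int[P]_w cos (t * A n w)| <= expR (- (k / 2 * n%:R * (t * n%:R) `^ alpha)).
Proof.
move=> t0 tn.
have [X_indep X_law] := X_iid.
rewrite (expectation_cos_weighted_sum X_indep _ _ _ X_law X_sym) normr_prod.
case: n => [|n] in tn *.
  by rewrite big_ord0 mulr0 mul0r oppr0 expR0.
have step (i : 'I_n.+1) : `|\int[P]_w cos (t * (n.+1 - i)%:R * X w)| <=
    expR (- (k * (t * n.+1%:R) `^ alpha * ((n.+1 - i)%:R / n.+1%:R))).
  have ni0 : 0 < (n.+1 - i)%:R :> R by rewrite ltr0n subn_gt0.
  have [||f0 f1] := charfun_decay (t := t * (n.+1 - i)%:R).
  - by rewrite mulr_gt0.
  - by rewrite (le_trans _ tn)// ler_pM2l// ler_nat leq_subr.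
  rewrite -/(charfun X _) ger0_norm// (le_trans f1)// ler_expR lerN2.
  rewrite -mulrA ler_pM2l//.
  have -> : t * (n.+1 - i)%:R = (t * n.+1%:R) * ((n.+1 - i)%:R / n.+1%:R).
    by field; rewrite nat1r pnatr_eq0.
  rewrite [leRHS]powRM ?mulr_ge0 ?divr_ge0 ?(ltW t0)//.
  rewrite ler_wpM2l ?powR_ge0// ger1_powR ?(ltW alpha_lt1)//.
  by rewrite divr_gt0//= ler_pdivrMr// mul1r ler_nat leq_subr.
apply: (@le_trans _ _ (\prod_(i < n.+1)
    expR (- (k * (t * n.+1%:R) `^ alpha * ((n.+1 - i)%:R / n.+1%:R))))).
  by apply: ler_prod => i _; rewrite normr_ge0 /=; exact: step.
rewrite -expR_sum ler_expR sumrN lerN2 -mulr_sumr -mulr_suml.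
have -> : \sum_(i < n.+1) (n.+1 - i)%:R = (n.+1%:R * n.+2%:R / 2 : R).
  elim: (n.+1) => [|m IH]; first by rewrite big_ord0 !mul0r.
  rewrite big_ord_recl subn0 /=; under eq_bigr do rewrite /bump /= add1n subSS.
  by rewrite IH -!natr1; field.
rewrite [leLHS](_ : _ = k * (t * n.+1%:R) `^ alpha * (n.+1%:R / 2)); last by ring.
rewrite ler_wpM2l ?mulr_ge0 ?powR_ge0 ?(ltW k_gt0)//.
have -> : n.+1%:R * n.+2%:R / 2 / n.+1%:R = n.+2%:R / 2 :> R.
  by field; rewrite nat1r pnatr_eq0.
by rewrite ler_pM2r// ler_nat.
Qed.

(** [fejer_concentration] with a grid of L points, L about n^gam: the point m = 0
    contributes 1 / L, and at the others the product formula yields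
    exp(-c n L^(-alpha)), which is smaller than any power of n because
    gam alpha < 1. *)
Lemma mean_concentration (K : R) : 0 < K ->
  exists gam C : R, [/\ 1 < gam, 0 < C & forall n, (0 < n)%N ->
    fine (P [set w | `|walk_mean X_ n w| <= K]) <= C * n%:R `^ (- gam)].
Proof.
move=> K0; have [kap kap0 fejer] := fejer_concentration P.
(* any exponent strictly between 1 and 1 / alpha would do *)
pose gam := (1 + alpha^-1) / 2; pose sig := (1 - alpha) / 2.
have alphaV : 1 < alpha^-1 by rewrite invf_gt1.
have sigE : 1 - gam * alpha = sig by rewrite /gam /sig; field; exact: lt0r_neq0.
have sig0 : 0 < sig by rewrite divr_gt0// subr_gt0.
(* the grid step is eta / (L n): eta <= kap / K is the range of the Fejer
   bound, eta <= del that of the decay of phi *)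
pose eta := Num.min (kap / K) del.
have eta0 : 0 < eta by rewrite lt_min del_gt0 divr_gt0.
pose c := k / 2 * (eta / 2) `^ alpha.
have c0 : 0 < c by rewrite mulr_gt0 ?powR_gt0 ?divr_gt0.
have [C C0 hC] := expRN_le_powRN gam c0 sig0.
exists gam, (4 + 4 * C); split.
- by rewrite /gam; lra.
- by rewrite addr_gt0// mulr_gt0.
move=> n n0; have n0R : 0 < n%:R :> R by rewrite ltr0n.
have n1R : 1 <= n%:R :> R by rewrite ler1n.
have gam0 : 0 <= gam by rewrite /gam; lra.
have ngam : 1 <= n%:R `^ gam :> R by have := ler_powR n1R gam0; rewrite powRr0.
pose L := (Num.truncn (n%:R `^ gam : R)).+1.
have Lge : n%:R `^ gam <= L%:R by exact/ltW/truncnS_gt.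
have Lle : L%:R <= 2 * n%:R `^ gam.
  have := truncn_le (n%:R `^ gam : R).
  by rewrite powR_ge0 /L -natr1; move: ngam; lra.
have L0 : 0 < L%:R :> R by rewrite ltr0n.
pose dl := eta / (L%:R * n%:R).
have dl0 : 0 < dl by rewrite divr_gt0// mulr_gt0.
have -> : [set w | `|walk_mean X_ n w| <= K] = [set w | `|A n w| <= K * n%:R].
  have meanE w : (`|walk_mean X_ n w| <= K) = (`|A n w| <= K * n%:R).
    rewrite walk_meanE normrM (@ger0_norm _ n%:R^-1) ?invr_ge0//.
    by rewrite [X in X <= _]mulrC ler_pdivrMr.
  by apply/seteqP; split => w /=; rewrite meanE.
have mA : measurable_fun setT (A n) by exact: measurable_weighted_sum.
have := fejer (A n) L dl (K * n%:R) mA (ltW dl0) isT.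
have -> : L%:R * dl * (K * n%:R) = eta * K.
  by rewrite /dl; field; rewrite !lt0r_neq0.
have etaK : eta * K <= kap by rewrite -ler_pdivlMr// ge_min lexx.
move=> /(_ etaK) bound.
have dlE (m : nat) : m%:R * dl * n%:R = eta * (m%:R / L%:R).
  by rewrite /dl; field; rewrite !lt0r_neq0.
have term (m : nat) : (m < L)%N -> (0 < m)%N ->
    `|\int[P]_w cos (m%:R * dl * A n w)| <= C * n%:R `^ (- gam).
  move=> mL m0; have m0R : 1 <= m%:R :> R by rewrite ler1n.
  have mL1 : m%:R / L%:R <= 1 :> R by rewrite ler_pdivrMr// mul1r ler_nat ltnW.
  apply: le_trans (hC n n0).
  apply: le_trans (expectation_cos_cumulated_walk_le _ _) _.
  - by rewrite mulr_gt0// ltr0n.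
  - rewrite dlE (@le_trans _ _ eta)//; last by rewrite ge_min lexx orbT.
    by rewrite ler_piMr// ltW.
  rewrite ler_expR lerN2 dlE /c -mulrA -[leRHS]mulrA ler_pM2l ?divr_gt0//.
  have h1 : (eta / 2 * n%:R `^ (- gam)) `^ alpha <= (eta * (m%:R / L%:R)) `^ alpha.
    rewrite ge0_ler_powR ?nnegrE ?mulr_ge0 ?powR_ge0 ?(ltW eta0) ?(ltW alpha_gt0)//.
    rewrite -mulrA ler_pM2l// powRN.
    rewrite (@le_trans _ _ L%:R^-1)//.
      by rewrite -invfM lef_pV2// posrE mulr_gt0// powR_gt0.
    by rewrite -[leLHS]mul1r ler_wpM2r.
  have h2 : (eta / 2) `^ alpha * n%:R `^ sig =
      n%:R * (eta / 2 * n%:R `^ (- gam)) `^ alpha.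
    rewrite (@powRM _ (eta / 2)) ?powR_ge0 ?divr_ge0 ?(ltW eta0)// mulrCA.
    congr (_ * _).
    rewrite -powRrM -{2}(@powRr1 _ n%:R)// -powRD; last by rewrite lt0r_neq0 ?implybT.
    by rewrite mulNr sigE.
  by rewrite h2 ler_pM2l.
have sum_le : \sum_(m < L) `|\int[P]_w cos (m%:R * dl * A n w)| <=
    1 + L%:R * (C * n%:R `^ (- gam)).
  rewrite /L big_ord_recl lerD//.
    rewrite /= mul0r; under eq_Rintegral do rewrite mul0r cos0.
    by rewrite expectation_cst normr1.
  rewrite (@le_trans _ _
    (\sum_(i < Num.truncn (n%:R `^ gam : R)) C * n%:R `^ (- gam)))//.
    by apply: ler_sum => i _; apply: term => //=; rewrite /bump /= ltnS ltn_ord.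
  rewrite sumr_const card_ord -[leLHS]mulr_natl ler_wpM2r//.
    by rewrite mulr_ge0 ?powR_ge0 ?ltW.
  by rewrite ler_nat.
have Linv : L%:R^-1 <= n%:R `^ (- gam).
  by rewrite powRN lef_pV2 ?posrE ?powR_gt0.
rewrite -(@ler_pM2r _ L%:R)// (le_trans bound)//.
rewrite (le_trans (ler_wpM2l _ sum_le))//.
have : 1 <= n%:R `^ (- gam) * L%:R by rewrite -ler_pdivrMr// mul1r.
lra.
Qed.

End mean_concentration.

(** * Almost sure behaviour *)

Section oscillation.
Context {R : realType}.
Implicit Types u v : nat -> R.

Definition unbounded_above u : Prop :=
  forall K : nat, exists2 j, (K <= j)%N & K%:R < u j.

Lemma unbounded_above_bounded_diff u v (B : R) :
  (forall j, `|u j - v j| <= B) -> unbounded_above u -> unbounded_above v.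
Proof.
move=> uvB uU K.
have [j jK uj] := uU (maxn K (Num.truncn (K%:R + B)).+1).
exists j; first by rewrite (leq_trans _ jK)// leq_maxl.
have h1 : K%:R + B < u j.
  apply: lt_trans uj; apply: lt_le_trans (truncnS_gt _) _.
  by rewrite ler_nat leq_maxr.
have := uvB j; rewrite ler_norml => /andP[_]; lra.
Qed.

Lemma limn_esup_unbounded u : unbounded_above u ->
  limn_esup (fun n => (u n)%:E) = +oo%E.
Proof.
move=> uU; rewrite /limn_esup limf_esupE; apply/eqP; rewrite -leye_eq.
apply: le_ereal_inf_tmp => _ [V [N _ NV] <-]; rewrite leye_eq; apply/eqP.
apply: eq_infty => t.
have [j jN uj] := uU (maxn N (Num.truncn t).+1).
apply: le_trans (ereal_sup_ubound _); last first.
  exists j => //; apply: NV => /=; exact: leq_trans (leq_maxl _ _) jN.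
rewrite lee_fin ltW// (lt_trans _ uj)// (lt_le_trans (truncnS_gt _))//.
by rewrite ler_nat leq_maxr.
Qed.

Lemma limn_einf_unbounded u : unbounded_above (fun n => - u n) ->
  limn_einf (fun n => (u n)%:E) = -oo%E.
Proof.
move=> /limn_esup_unbounded uU.
by rewrite -[LHS]/(- limn_esup (fun n => (- u n)%:E))%E uU.
Qed.

End oscillation.

Section almost_sure_behaviour.
Context {d : measure_display} {T : measurableType d} {R : realType}.
Variables (P : probability T R) (X : {RV P >-> R}) (X_ : nat -> {RV P >-> R}).
Hypothesis X_iid : iid_copies X X_.
Hypothesis X_sym : symmetric_law P X.

Let X_indep : mutually_independent X_. Proof. by case: X_iid. Qed.

Let mG n : measurable_fun setT (walk_mean X_ n).
Proof. exact: measurable_walk_mean. Qed.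

(** Borel-Cantelli for each integer level K + 1, the events being indexed from
    n = 1 on. *)
Lemma abs_walk_mean_cvgy :
  (forall K : R, 0 < K -> exists gam C : R, [/\ 1 < gam, 0 < C & forall n,
    (0 < n)%N ->
    fine (P [set w | `|walk_mean X_ n w| <= K]) <= C * n%:R `^ (- gam)]) ->
  {ae P, forall w, `|walk_mean X_ n w| @[n --> \oo] --> +oo}.
Proof.
move=> conc.
have step (K : nat) : {ae P, forall w, exists N, forall n, (N <= n)%N ->
    K.+1%:R < `|walk_mean X_ n w|}.
  have [gam [C [gam1 C0 hC]]] := conc K.+1%:R (ltr0Sn _ _).
  pose F n := [set w | `|walk_mean X_ n.+1 w| <= K.+1%:R].
  have mF n : measurable (F n).
    rewrite -[X in measurable X]setTI.
    apply: (@measurable_fun_le _ _ _ setT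
      (fun w => `|walk_mean X_ n.+1 w|) (cst _)) => //.
    exact: measurableT_comp.
  have [D D0 hD] := sum_powRN_le gam1.
  have F0 : P (lim_sup_set F) = 0%E.
    apply: lim_sup_set_cvg0 => //.
    apply: (@le_lt_trans _ _ (C * D)%:E); last exact: ltry.
    apply: lime_le; first exact: is_cvg_nneseries.
    apply: nearW => N; rewrite big_mkord.
    rewrite (_ : \sum_(i < N) P (F i) = (\sum_(i < N) fine (P (F i)))%:E)%E; last first.
      rewrite -sumEFin; apply: eq_bigr => i _.
      by rewrite fineK// fin_num_measure.
    rewrite lee_fin (@le_trans _ _ (\sum_(i < N) C * i.+1%:R `^ (- gam)))//.
      by apply: ler_sum => i _; exact: hC.
    by rewrite -mulr_sumr ler_pM2l.
  exists (lim_sup_set F); split => //.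
    apply: bigcapT_measurable => n; exact: bigcup_measurable.
  move=> w /= nw n _; apply: contrapT => h; apply: nw; exists n.+1 => m nm.
  rewrite ltNge; apply/negP => Fm; apply: h; exists m.-1 => /=; first lia.
  by rewrite /F /= prednK//; lia.
have := ae_foralln step; apply: filterS => w hw.
apply/cvgryPge => A.
have [N hN] := hw (Num.truncn A).
exists N => // n /= Nn; rewrite ltW// (lt_trans _ (hN n Nn))//.
exact: truncnS_gt.
Qed.

(** The factor [r] is 1 for limsup = +oo and -1 for liminf = -oo. *)
Definition unbounded_event (r : R) : set T :=
  [set w | unbounded_above (fun n => r * walk_mean X_ n w)].

(** Dropping the first n variables from the j-th mean changes it by at most
    sum_(i < n) |X_i|, as their weights (j - i) / j are at most 1. *)
Lemma unbounded_event_tail (r : R) (n : nat) :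
  <<s cylinders X_ [set i | (n <= i)%N] >> (unbounded_event r).
Proof.
pose H j w := j%:R^-1 * \sum_(i <- index_iota n j) (j - i)%:R * X_ i w.
have -> : unbounded_event r = \bigcap_K \bigcup_(j in [set j | (K <= j)%N])
    [set w | K%:R < r * H j w].
  pose B w := `|r| * \sum_(i < n) `|X_ i w|.
  have GH w j : `|r * walk_mean X_ j w - r * H j w| <= B w.
    rewrite -mulrBr normrM ler_wpM2l// walk_meanE -mulrBr.
    rewrite /weighted_sum -(big_mkord xpredT (fun i => (j - i)%:R * X_ i w)).
    have sumB : `|\sum_(0 <= i < j) (j - i)%:R * X_ i w -
        \sum_(i <- index_iota n j) (j - i)%:R * X_ i w| <=
        j%:R * \sum_(i < n) `|X_ i w|.
      have bnd m : (m <= n)%N -> `|\sum_(0 <= i < m) (j - i)%:R * X_ i w| <=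
          j%:R * \sum_(i < n) `|X_ i w|.
        move=> mn; rewrite -(big_mkord xpredT (fun i => `|X_ i w|)).
        rewrite (le_trans (ler_norm_sum _ _ _))//.
        rewrite [X in _ <= _ * X](big_cat_nat (n := m))//= mulrDr.
        rewrite (@le_trans _ _ (j%:R * \sum_(0 <= i < m) `|X_ i w|))//.
          rewrite mulr_sumr; apply: ler_sum => i _.
          by rewrite normrM ler_wpM2r// normr_nat ler_nat leq_subr.
        by rewrite lerDl mulr_ge0// sumr_ge0.
      have [jn|nj] := leqP j n.
        by rewrite [X in _ - X]big_geq// subr0; exact: bnd.
      rewrite (big_cat_nat (n := n)) ?(ltnW nj)//= addrK; exact: bnd.
    rewrite normrM ger0_norm ?invr_ge0//.
    case: j sumB => [|j] sumB; first by rewrite invr0 mul0r sumr_ge0.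
    by rewrite mulrC ler_pdivrMr// mulrC.
  apply/seteqP; split => w hw.
    move=> K _; have [j Kj Hj] := unbounded_above_bounded_diff (GH w) hw K.
    by exists j.
  apply: (@unbounded_above_bounded_diff _ (fun j => r * H j w) _ (B w)).
    by move=> j; rewrite distrC.
  by move=> K; have [j Kj Hj] := hw K I; exists j.
pose TT : measurableType _ :=
  g_sigma_algebraType (cylinders X_ [set i | (n <= i)%N]).
apply: (@bigcapT_measurable _ TT) => K.
apply: (@bigcup_measurable _ TT) => j _.
suff mH : measurable_fun setT (fun w : TT => r * H j w).
  rewrite (_ : [set w | _] = (fun w => r * H j w) @^-1` `]K%:R, +oo[).
    by rewrite -[X in measurable X]setTI; exact: mH.
  by apply/seteqP; split => w /=; rewrite in_itv /= andbT.
do 2 apply: measurable_funM => //.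
apply: generated_measurable_sum => i.
by rewrite mem_index_iota => /andP[].
Qed.

Lemma measurable_unbounded_event (r : R) : measurable (unbounded_event r).
Proof.
have: <<s cylinders X_ [set i | (0 <= i)%N] >> `<=` @measurable _ T.
  apply: smallest_sub; first exact: sigma_algebra_measurable.
  exact: cylinders_measurable.
by apply; exact: unbounded_event_tail.
Qed.

Lemma probability_walk_mean_ge0 (r : R) n :
  ((2^-1)%:E <= P [set w | (0 <= r * walk_mean X_ n w)%R])%E.
Proof.
pose Y w := r * walk_mean X_ n w.
have mY : measurable_fun setT Y by exact: measurable_funM.
have sY : symmetric_law P Y.
  apply: symmetric_lawZ.
  rewrite (_ : walk_mean X_ n =
    fun w => n%:R^-1 * weighted_sum X_ (fun i => (n - i)%:R) n w).
    apply: symmetric_lawZ; apply: symmetric_weighted_sum => // i.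
    exact: symmetric_law_identically_distributed (X_iid.2 i) X_sym.
  by apply/funext => w; exact: walk_meanE.
pose I0 : set R := `[0, +oo[%classic.
have mI0 : measurable I0 by exact: measurable_itv.
have m0 : measurable (Y @^-1` I0).
  by rewrite -[X in measurable X]setTI; exact: mY.
have m1 : measurable ((\- Y) @^-1` I0).
  by rewrite -[X in measurable X]setTI; apply: measurableT_comp.
have -> : [set w | 0 <= r * walk_mean X_ n w] = Y @^-1` I0.
  by apply/seteqP; split => w /=; rewrite /I0 /= in_itv /= andbT.
have : (1 <= P (Y @^-1` I0) + P ((\- Y)%R @^-1` I0))%E.
  rewrite -(probability_setT P) (_ : setT = Y @^-1` I0 `|` (\- Y) @^-1` I0).
    exact: measureU2.
  apply/seteqP; split => // w _ /=; rewrite /I0 /= !in_itv /= !andbT.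
  by have [|] := leP 0 (Y w); [left|right; rewrite oppr_ge0 ltW].
rewrite -(sY I0 mI0).
rewrite -[P _]fineK ?fin_num_measure// -EFinD !lee_fin; lra.
Qed.

(** Off the null set where |G_n| does not diverge, r G_n >= 0 infinitely often
    forces r G_n to be unbounded above. *)
Lemma probability_unbounded_event (r : R) : r != 0 ->
  {ae P, forall w, `|walk_mean X_ n w| @[n --> \oo] --> +oo} ->
  P (unbounded_event r) = 1%E.
Proof.
move=> r0 [N [mN N0 divN]].
pose F n := [set w | 0 <= r * walk_mean X_ n w].
have mF n : measurable (F n).
  rewrite -[X in measurable X]setTI.
  apply: (@measurable_fun_le _ _ _ setT
    (cst 0) (fun w => r * walk_mean X_ n w)) => //.
  exact: measurable_funM.
have mlimF : measurable (lim_sup_set F).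
  by apply: bigcapT_measurable => n; exact: bigcup_measurable.
have tailE := unbounded_event_tail r.
have mE := measurable_unbounded_event r.
have P_ge : ((2^-1)%:E <= P (lim_sup_set F))%E.
  have limF : P (\bigcup_(k >= n) F k) @[n --> \oo] --> P (lim_sup_set F).
    apply: lim_sup_set_cvg => //.
    rewrite (le_lt_trans (probability_le1 _ _)) ?ltry//.
    exact: bigcup_measurable.
  rewrite -(cvg_lim _ limF)//; apply: lime_ge.
    by apply/cvg_ex; exists (P (lim_sup_set F)).
  apply: nearW => n; rewrite (le_trans (probability_walk_mean_ge0 r n))//.
  apply: le_measure; rewrite ?inE; [exact: mF|exact: bigcup_measurable|].
  by move=> w Fw; exists n => /=.
have subE : lim_sup_set F `<=` unbounded_event r `|` N.
  move=> w Fw; have [wN|wN] := pselect (N w); [by right|left => K].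
  have cvgw : `|walk_mean X_ n w| @[n --> \oo] --> +oo.
    by apply: contrapT => h; apply: wN; exact: divN.
  move/cvgryPgt : cvgw => /(_ (K%:R / `|r|))[M _ hM].
  have [j /= jM Fj] := Fw (maxn K M) I.
  exists j; first by rewrite (leq_trans _ jM)// leq_maxl.
  have := hM j; rewrite /= (leq_trans (leq_maxr _ _) jM) => /(_ isT).
  rewrite ltr_pdivrMr ?normr_gt0// mulrC -normrM ger0_norm//.
have half_le : ((2^-1)%:E <= P (unbounded_event r))%E.
  rewrite (le_trans P_ge)// -[leRHS]adde0 -N0.
  rewrite (le_trans _ (measureU2 _ _ _))// le_measure ?inE//.
  exact: measurableU.
case: (kolmogorov_zero_one X_indep tailE) => // E0.
by exfalso; move: half_le; rewrite E0 lee_fin; lra.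
Qed.

End almost_sure_behaviour.

Theorem theorem7p4p2 (d : measure_display) (T : measurableType d)
    (R : realType) (P : probability T R)
    (X : {RV P >-> R}) (X_ : nat -> {RV P >-> R})
    (X_iid : iid_copies X X_)
    (b h : R) (h_gt0 : 0 < h)
    (X_lattice : P (X @^-1` lattice b h) = 1%E)
    (h_max : forall b' h' : R, 0 < h' ->
      P (X @^-1` lattice b' h') = 1%E -> h' <= h)
    (X_sym : identically_distributed P X (\- X))
    (alpha : R) (alpha_gt0 : 0 < alpha) (alpha_lt1 : alpha < 1)
    (mu : probability R R) (mu_stable : symmetric_stable alpha mu)
    (X_attr : normal_attraction X_ alpha mu) :
  {ae P, forall w : T,
    [/\ limn_einf (fun n => (walk_mean X_ n w)%:E) = -oo%E,
        limn_esup (fun n => (walk_mean X_ n w)%:E) = +oo%E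
      & `|walk_mean X_ n w| @[n --> \oo] --> +oo]}.
Proof.
have [k [del [k0 del0 decay]]] :=
  charfun_le_expR X_iid X_sym alpha_gt0 mu_stable X_attr.
have div := abs_walk_mean_cvgy (fun K =>
  mean_concentration X_iid X_sym alpha_gt0 alpha_lt1 k0 del0 decay (K := K)).
have unb (r : R) : r != 0 -> {ae P, forall w, unbounded_event X_ r w}.
  move=> r0; exists (~` unbounded_event X_ r); split => //.
    exact/measurableC/measurable_unbounded_event.
  rewrite probability_setC; last exact: measurable_unbounded_event.
  by rewrite (probability_unbounded_event X_iid X_sym r0 div) subee.
have N1 : -1 != 0 :> R by rewrite oppr_eq0 oner_eq0.
apply: filterS3 div (unb 1 (oner_neq0 _)) (unb (-1) N1) => w divw up low.
split => //; [apply: limn_einf_unbounded|apply: limn_esup_unbounded] => K.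
  by have [j Kj] := low K; rewrite mulN1r; exists j.
by have [j Kj] := up K; rewrite mul1r; exists j.
Qed.
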